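(* Let $N\ge2$, $R>0$, let $g:[0,R]\to(0,\infty)$ be smooth, and let $A,B,p,q$ be positive constants with $A\ne B$, all independent of $\epsilon$. For $\epsilon>0$ let $U_\epsilon$ be the unique solution of problem (N* ) described in the context, and let $\rho_\epsilon$ be as in the context. If $0<A<B$ (resp. $0<B<A$), then $U_\epsilon$ is monotonically decreasing (resp. increasing) on $[0,R]$. Moreover: (I) For every $\kappa\in(0,1)$ independent of $\epsilon$ there are positive constants $C_\kappa,M_\kappa$ independent of $\epsilon$ such that for all sufficiently small $\epsilon>0$, $$\max_{r\in[0,R-\epsilon^\kappa]}|U_\epsilon(r)|\le C_\kappa\epsilon^\kappa\log\frac1\epsilon\quad\text{and}\quad\max_{r\in[0,R-\epsilon^\kappa]}r^{N-1}|U_\epsilon'(r)|\le e^{-M_\kappa/\epsilon^{1-\kappa}}.$$ (II) Let $\beta>1$ and $\gamma_\beta\in(0,\infty)$ be independent of $\epsilon$ and let $r_{\epsilon,\beta}\in(0,R)$ satisfy $\lim_{\epsilon\downarrow0}\frac{R-r_{\epsilon,\beta}}{\epsilon^\beta}=\gamma_\beta$. Define $\chi_1(\beta)=1,\chi_2(\beta)=0$ for $\beta\in(1,2)$; $\chi_1(\beta)=\chi_2(\beta)=1$ for $\beta=2$; $\chi_1(\beta)=0,\chi_2(\beta)=1$ for $\beta>2$. Then as $\epsilon\downarrow0$, $$U_\epsilon(r_{\epsilon,\beta})=-\frac2q\min\{1,\beta-1\}\log\frac1\epsilon+\frac2q\log\Big[\sqrt{\frac{A}{2qg(R)}}\Big(\gamma_\beta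 q\chi_1(\beta)+\frac{2Ng(R)}{R(B-A)}\chi_2(\beta)\Big)\Big]+o_\epsilon(1)\quad\text{if }0<A<B,$$ $$U_\epsilon(r_{\epsilon,\beta})=\frac2p\min\{1,\beta-1\}\log\frac1\epsilon-\frac2p\log\Big[\sqrt{\frac{B}{2pg(R)}}\Big(\gamma_\beta p\chi_1(\beta)+\frac{2Ng(R)}{R(A-B)}\chi_2(\beta)\Big)\Big]+o_\epsilon(1)\quad\text{if }0<B<A.$$ Furthermore, if $0<A<B$, then as $\epsilon\downarrow0$: (a) if $1<\beta<2$: $U_\epsilon'(r_{\epsilon,\beta})=-\frac{2}{\gamma_\beta q}\epsilon^{-\beta}(1+o_\epsilon(1))$ and $\rho_\epsilon(r_{\epsilon,\beta})=\frac{2g(R)}{\gamma_\beta^2q}\epsilon^{-2(\beta-1)}(1+o_\epsilon(1))$; (b) if $\beta=2$: $U_\epsilon'(r_{\epsilon,\beta})=-\frac{2}{\gamma_\beta q+\frac{2Ng(R)}{R(B-A)}}\epsilon^{-2}(1+o_\epsilon(1))$ and $\rho_\epsilon(r_{\epsilon,\beta})=\frac{2qg(R)}{(\gamma_\beta q+\frac{2Ng(R)}{R(B-A)})^2}\epsilon^{-2}(1+o_\epsilon(1))$; (c) if $\beta>2$: $U_\epsilon'(r_{\epsilon,\beta})=-\frac{R(B-A)}{Ng(R)}\epsilon^{-2}(1+o_\epsilon(1))$ and $\rho_\epsilon(r_{\epsilon,\beta})=\frac{qR^2(B-A)^2}{2N^2g(R)}\epsilon^{-2}(1+o_\epsilon(1))$;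 in this case $U_\epsilon(r_{\epsilon,\beta})$ and $U_\epsilon(R)$ have the same first two terms in their asymptotic expansions, and $U_\epsilon'(r_{\epsilon,\beta})$ and $U_\epsilon'(R)$ have the same leading order term.
   Context: Problem (N* ): for $\epsilon>0$, find $U_\epsilon\in C^1([0,R])\cap C^\infty((0,R))$ such that for $r\in(0,R)$ $$\epsilon^2 g(r)\Big[U_\epsilon''(r)+\Big(\frac{N-1}{r}+\frac{g'(r)}{g(r)}\Big)U_\epsilon'(r)\Big]=\frac{R^N}{N}\Big(\frac{Ae^{pU_\epsilon(r)}}{\int_0^R s^{N-1}e^{pU_\epsilon(s)}ds}-\frac{Be^{-qU_\epsilon(r)}}{\int_0^R s^{N-1}e^{-qU_\epsilon(s)}ds}\Big),$$ together with $\int_0^R s^{N-1}U_\epsilon(s)\,ds=0$, $U_\epsilon'(0)=0$ and $U_\epsilon'(R)=\frac{R(A-B)}{\epsilon^2Ng(R)}$; it has a unique solution. The net charge density is $\rho_\epsilon(r)=-\frac{R^N}{N}\big(\frac{Ae^{pU_\epsilon(r)}}{\int_0^Rs^{N-1}e^{pU_\epsilon(s)}ds}-\frac{Be^{-qU_\epsilon(r)}}{\int_0^Rs^{N-1}e^{-qU_\epsilon(s)}ds}\big)$. Notation: $o_\epsilon(1)$ denotes a quantity tending to $0$ as $\epsilon\downarrow0$. *)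

(* Defs.v *)
From Stdlib Require Import Reals.
From Coquelicot Require Import Coquelicot.
Open Scope R_scope.

(* g smooth: all derivatives exist everywhere (smooth extension of g from [0,R]) *)
Definition smooth (g : R -> R) : Prop := forall (n : nat) (x : R), ex_derive_n g n x.

Definition deriv_within (a b : R) (u du : R -> R) (x : R) : Prop :=
  filterlim (fun h => (u (x + h) - u x) / h)
    (within (fun h => h <> 0 /\ a <= x + h <= b) (locally 0)) (locally (du x)).

Definition C1_closed (a b : R) (u du : R -> R) : Prop :=
  (forall x, a <= x <= b -> deriv_within a b u du x) /\
  (forall x, a <= x <= b ->
     filterlim du (within (fun y => a <= y <= b) (locally x)) (locally (du x))).

Definition Cinf_open (a b : R) (u : R -> R) : Prop :=
  forall (n : nat) (x : R), a < x < b -> ex_derive_n u n x.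

Definition nstar_rhs (N : nat) (Rad A B p q : R) (u : R -> R) (r : R) : R :=
  Rad ^ N / INR N *
  (A * exp (p * u r) / RInt (fun s => s ^ (N - 1) * exp (p * u s)) 0 Rad
   - B * exp (- q * u r) / RInt (fun s => s ^ (N - 1) * exp (- q * u s)) 0 Rad).

Definition rho (N : nat) (Rad A B p q : R) (u : R -> R) (r : R) : R :=
  - nstar_rhs N Rad A B p q u r.

Definition solves_Nstar (N : nat) (Rad : R) (g : R -> R) (A B p q eps : R)
  (u du : R -> R) : Prop :=
  C1_closed 0 Rad u du /\
  Cinf_open 0 Rad u /\
  (forall r, 0 < r < Rad ->
     eps ^ 2 * g r * (Derive du r + ((INR N - 1) / r + Derive g r / g r) * du r)
     = nstar_rhs N Rad A B p q u r) /\
  RInt (fun s => s ^ (N - 1) * u s) 0 Rad = 0 /\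
  du 0 = 0 /\
  du Rad = Rad * (A - B) / (eps ^ 2 * INR N * g Rad).

Definition chi1 (beta : R) : R := if Rle_dec beta 2 then 1 else 0.
Definition chi2 (beta : R) : R := if Rlt_dec beta 2 then 0 else 1.

(* Main.v *)
Require Import Defs.
From Stdlib Require Import Reals Lra Lia.
From Coquelicot Require Import Coquelicot.
Open Scope R_scope.

(* Replacing [u] by [-u] exchanges [(A, p)] and [(B, q)], so let [B < A]. With the two integrals
   frozen into constants [a], [b] the equation reads [eps^2 phi' = r^(N-1) F(u)], where
   [phi = r^(N-1) g u'] is the flux and [F(y) = a e^(py) - b e^(-qy)] is increasing.

   The flux cannot have a negative minimum, hence [u] increases and [F(u) >= 0]. At [r = 0] this
   gives [B <= b e^(-q u(0)) <= a e^(p u(0))], so [F'(u) >= pB] uniformly in [eps]. Therefore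
   [phi'' >= (lam/eps)^2 phi] and the flux decays like [e^(-lam (R-r)/eps)] away from the boundary;
   with the zero mean of [u] this yields (I), and [a], [b -> B].

   Near the boundary the energy identity [(eps^2 phi^2 / 2)' = r^(2(N-1)) g F(u) u'] shows that
   [v = e^(-pu/2)] satisfies [eps v' -> - sqrt (pB / (2 g(R)))] uniformly as long as [v] is small.
   The boundary condition fixes [v(R) / eps], and integrating [v'] from [r_eps] to [R] gives (II). *)

(** The factors [a] and [b] depend on the unknown solution, so every constant must come from bounds
    on them that do not involve [eps]: Jensen's inequality with the zero mean gives [a <= A] and
    [b <= B], and monotonicity of [u] gives [B <= a]. The choice of [v] comes from the limit
    equation. Near the boundary the problem resembles the Liouville equation
    [eps^2 g u'' = B e^(pu)], whose first integral [eps^2 g u'^2 / 2 = (B/p) e^(pu)] says that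
    [e^(-pu/2)] is affine with slope of order [1/eps]. The obstacle is a circularity: this slope is
    known only where [u] is large, while that [u] is large up to [r_eps] is part of what is to be
    shown. A cruder slope bound, valid without any largeness, breaks the circle. The exponent
    [min(1, beta - 1)] records a competition: [v(R)] has order [eps], and the increment of [v] over
    a distance [eps^beta] has order [eps^(beta-1)]. *)

Lemma mean_value (f df : R -> R) (a b : R) :
  a < b -> (forall x, a < x < b -> is_derive f x (df x)) ->
  (forall x, a <= x <= b -> continuous f x) ->
  exists c, a < c < b /\ f b - f a = df c * (b - a).
Proof.
  intros Hab Hd Hc.
  assert (pr : forall c, a < c < b -> derivable_pt f c).
  { intros c Hc'. exists (df c). apply is_derive_Reals, Hd, Hc'. }
  destruct (MVT f id a b pr (fun c _ => derivable_pt_id c) Hab) as [c [P H]].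
  - intros c H; apply continuity_pt_filterlim, Hc, H.
  - intros c _; apply derivable_continuous_pt, derivable_pt_id.
  - exists c; split; [exact P |].
    rewrite derive_pt_id in H. unfold id in H.
    rewrite Derive_Reals, (is_derive_unique f c (df c)) in H by now apply Hd.
    lra.
Qed.

Lemma nondecreasing_of_deriv (f df : R -> R) (a b : R) :
  a <= b -> (forall x, a < x < b -> is_derive f x (df x)) ->
  (forall x, a <= x <= b -> continuous f x) ->
  (forall x, a < x < b -> 0 <= df x) -> f a <= f b.
Proof.
  intros [Hab | <-] Hd Hc Hp; [| lra].
  destruct (mean_value f df a b Hab Hd Hc) as [c [Hc' H]].
  assert (0 <= df c * (b - a)) by (apply Rmult_le_pos; [apply Hp, Hc' | lra]).
  lra.
Qed.

(* [auto_derive] leaves derivatives of eta-expanded functions. *)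
Lemma Derive_eta (f : R -> R) (x l : R) : is_derive f x l -> Derive (fun y : R => f y) x = l.
Proof. apply is_derive_unique. Qed.

Lemma continuous_pow (n : nat) (x : R) : continuous (fun s => s ^ n) x.
Proof. apply (ex_derive_continuous (fun s => s ^ n) x). auto_derive; auto. Qed.

Lemma continuous_Rmult (f h : R -> R) (x : R) :
  continuous f x -> continuous h x -> continuous (fun s => f s * h s) x.
Proof. intros Hf Hh. now apply (continuous_mult f h). Qed.

Lemma continuous_exp_scal (f : R -> R) (k x : R) :
  continuous f x -> continuous (fun s => exp (k * f s)) x.
Proof.
  intros Hf. apply continuous_comp; [| apply continuous_exp].
  apply continuous_Rmult; [apply continuous_const | exact Hf].
Qed.

Lemma exp_mono_le (x y : R) : x <= y -> exp x <= exp y.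
Proof. intros [H | ->]; [left; now apply exp_increasing | lra]. Qed.

Lemma Rpower_pos (x y : R) : 0 < Rpower x y.
Proof. apply exp_pos. Qed.

Lemma Rpower_small (s eta : R) : 0 < s -> 0 < eta ->
  exists e0, 0 < e0 /\ forall e, 0 < e < e0 -> Rpower e s < eta.
Proof.
  intros Hs Heta. exists (Rpower eta (/ s)). split; [apply Rpower_pos |].
  intros e He. replace eta with (Rpower (Rpower eta (/ s)) s).
  - now apply Rlt_Rpower_l.
  - rewrite Rpower_mult, Rinv_l, Rpower_1; lra.
Qed.

(** With [y = - ln e] the claim becomes [(m + 1) y <= c e^(sy)]. Since [e^(sy) >= (sy/2)^2], it
    holds once [y] exceeds [4 (m + 1) / (c s^2)], which is the origin of [Y]. *)
Lemma exp_decay_beats_power (c s m : R) : 0 < c -> 0 < s ->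
  exists e0, 0 < e0 /\ forall e, 0 < e < e0 ->
    Rpower e (- m) * exp (- (c * Rpower e (- s))) <= e.
Proof.
  intros Hc Hs. set (Y := Rmax 0 (4 * (m + 1) / (c * s ^ 2))).
  exists (exp (- Y)). split; [apply exp_pos |]. intros e [He He0].
  set (y := - ln e).
  assert (Hy : Y < y).
  { unfold y. apply ln_increasing in He0; [| easy]. rewrite ln_exp in He0. lra. }
  assert (HY0 : 0 <= Y) by apply Rmax_l.
  assert (HY1 : 4 * (m + 1) / (c * s ^ 2) <= Y) by apply Rmax_r.
  assert (Hcs : 0 < c * s ^ 2) by (apply Rmult_lt_0_compat; [easy | now apply pow_lt]).
  assert (Hm : m + 1 <= c * s ^ 2 / 4 * y).
  { apply Rmult_le_reg_r with (4 / (c * s ^ 2)); [apply Rdiv_lt_0_compat; lra |].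
    replace (c * s ^ 2 / 4 * y * (4 / (c * s ^ 2))) with y by (field; lra).
    unfold Rdiv in *. lra. }
  unfold Rpower. replace (- m * ln e) with (m * y) by (unfold y; ring).
  replace (- s * ln e) with (s * y) by (unfold y; ring).
  rewrite <- exp_plus. rewrite <- (exp_ln e) at 1 by easy.
  apply exp_mono_le. replace (ln e) with (- y) by (unfold y; ring).
  assert (Hsy : 0 < s * y) by (apply Rmult_lt_0_compat; lra).
  assert (He2 : (s * y / 2) ^ 2 <= exp (s * y)).
  { replace (exp (s * y)) with (exp (s * y / 2) ^ 2).
    - apply pow_incr. pose proof (exp_ineq1_le (s * y / 2)). lra.
    - simpl. rewrite Rmult_1_r, <- exp_plus. f_equal. lra. }
  assert (c * (s * y / 2) ^ 2 <= c * exp (s * y)) by (apply Rmult_le_compat_l; lra).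
  replace (c * (s * y / 2) ^ 2) with (c * s ^ 2 / 4 * y * y) in H by field.
  assert ((m + 1) * y <= c * s ^ 2 / 4 * y * y) by (apply Rmult_le_compat_r; lra).
  lra.
Qed.

(** * Limits as [eps] decreases to 0 *)

Notation lim0 f l := (filterlim f (at_right 0) (locally l)) (only parsing).

Lemma lim0_eps (f : R -> R) (l : R) :
  (forall eta, 0 < eta -> exists e0, 0 < e0 /\
     forall e, 0 < e < e0 -> Rabs (f e - l) <= eta) <-> lim0 f l.
Proof.
  split.
  - intros H. apply filterlim_locally. intros eta.
    destruct (H (eta / 2)) as [e0 [He0 H0]]; [pose proof (cond_pos eta); lra |].
    exists (mkposreal e0 He0). intros e Hb He.
    apply Rle_lt_trans with (eta / 2); [| pose proof (cond_pos eta); lra].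
    apply H0. split; [easy |].
    unfold ball in Hb; simpl in Hb; unfold AbsRing_ball, abs, minus, plus, opp in Hb; simpl in Hb.
    apply Rabs_def2 in Hb. lra.
  - intros H eta Heta.
    destruct (proj1 (filterlim_locally f l) H (mkposreal eta Heta)) as [d Hd].
    exists d. split; [apply cond_pos |]. intros e He. left. apply (Hd e); [| lra].
    unfold ball; simpl; unfold AbsRing_ball, abs, minus, plus, opp; simpl.
    apply Rabs_def1; lra.
Qed.

Lemma lim0_squeeze (f h k : R -> R) (l : R) :
  (exists e0, 0 < e0 /\ forall e, 0 < e < e0 -> f e <= h e <= k e) ->
  lim0 f l -> lim0 k l -> lim0 h l.
Proof.
  intros [e0 [He0 H]] Hf Hk.
  apply (filterlim_le_le f h k (Finite l)); [| exact Hf | exact Hk].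
  exists (mkposreal e0 He0). intros e Hb He. apply H. split; [easy |].
  unfold ball in Hb; simpl in Hb; unfold AbsRing_ball, abs, minus, plus, opp in Hb; simpl in Hb.
  apply Rabs_def2 in Hb. lra.
Qed.

Lemma lim0_ext (f h : R -> R) (l : R) :
  (forall e, 0 < e -> f e = h e) -> lim0 f l -> lim0 h l.
Proof.
  intros H Hf. apply (lim0_squeeze f h f); [| easy | easy].
  exists 1. split; [lra |]. intros e He. rewrite (H e) by lra. lra.
Qed.

Lemma lim0_val (f : R -> R) (l m : R) : l = m -> lim0 f l -> lim0 f m.
Proof. now intros ->. Qed.

Lemma lim0_const (l : R) : lim0 (fun _ => l) l.
Proof. apply filterlim_const. Qed.

Lemma lim0_plus (f h : R -> R) (l m : R) :
  lim0 f l -> lim0 h m -> lim0 (fun e => f e + h e) (l + m).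
Proof.
  intros Hf Hh. apply (filterlim_comp_2 f h plus Hf Hh).
  apply (filterlim_plus (V := R_NormedModule)).
Qed.

Lemma lim0_mult (f h : R -> R) (l m : R) :
  lim0 f l -> lim0 h m -> lim0 (fun e => f e * h e) (l * m).
Proof.
  intros Hf Hh. apply (filterlim_comp_2 f h mult Hf Hh).
  apply (filterlim_mult (K := R_AbsRing)).
Qed.

Lemma lim0_comp (h f : R -> R) (l : R) :
  lim0 f l -> ex_derive h l -> lim0 (fun e => h (f e)) (h l).
Proof.
  intros Hf Hh. apply (filterlim_comp _ _ _ f h _ _ _ Hf).
  now apply (@ex_derive_continuous R_AbsRing R_NormedModule).
Qed.

Lemma lim0_scal (k : R) (f : R -> R) (l : R) : lim0 f l -> lim0 (fun e => k * f e) (k * l).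
Proof. intros Hf. apply lim0_mult; [apply lim0_const | easy]. Qed.

Lemma lim0_div (f h : R -> R) (l m : R) :
  m <> 0 -> lim0 f l -> lim0 h m -> lim0 (fun e => f e / h e) (l / m).
Proof.
  intros Hm Hf Hh. apply lim0_mult; [easy |].
  apply (lim0_comp Rinv); [easy |]. auto_derive; easy.
Qed.

Lemma lim0_Rpower (s : R) : 0 < s -> lim0 (fun e => Rpower e s) 0.
Proof.
  intros Hs. apply lim0_eps. intros eta Heta.
  destruct (Rpower_small s eta Hs Heta) as [e0 [He0 H]].
  exists e0. split; [easy |]. intros e He. pose proof (Rpower_pos e s).
  rewrite Rminus_0_r, Rabs_right by lra. left; now apply H.
Qed.

Lemma lim0_id : lim0 (fun e => e) 0.
Proof.
  apply lim0_eps. intros eta Heta. exists eta. split; [easy |].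
  intros e He. rewrite Rminus_0_r, Rabs_right; lra.
Qed.

Lemma ln_le_Rpower (s e : R) : 0 < s -> 0 < e -> ln (1 / e) <= / s * Rpower e (- s).
Proof.
  intros Hs He. replace (1 / e) with (/ e) by (field; lra). rewrite ln_Rinv by easy.
  apply Rmult_le_reg_l with s; [easy |].
  rewrite <- Rmult_assoc, Rinv_r, Rmult_1_l by lra.
  unfold Rpower. pose proof (exp_ineq1_le (- s * ln e)). lra.
Qed.

Lemma continuous_near (f : R -> R) (x eta : R) : continuous f x -> 0 < eta ->
  exists d, 0 < d /\ forall y, Rabs (y - x) < d -> Rabs (f y - f x) < eta.
Proof.
  intros Hf Heta.
  destruct (proj1 (filterlim_locally f (f x)) Hf (mkposreal eta Heta)) as [d Hd].
  exists d. split; [apply cond_pos |]. intros y Hy. exact (Hd y Hy).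
Qed.

(** * The reaction term and the radial flux *)

Definition react (a b p q y : R) : R := a * exp (p * y) - b * exp (- q * y).

(** The potential in the energy identity. Among the primitives of [react] this one has two positive
    terms, so either term alone is a lower bound. *)
Definition react_prim (a b p q y : R) : R :=
  a / p * exp (p * y) + b / q * exp (- q * y).

Definition flux (N : nat) (g w : R -> R) (r : R) : R := r ^ (N - 1) * g r * w r.

Lemma is_derive_react (a b p q y : R) :
  is_derive (react a b p q) y (a * p * exp (p * y) + b * q * exp (- q * y)).
Proof. unfold react. auto_derive; [easy | ring]. Qed.

Lemma is_derive_react_prim (a b p q y : R) :
  0 < p -> 0 < q -> is_derive (react_prim a b p q) y (react a b p q y).
Proof. intros. unfold react_prim, react. auto_derive; [easy | field; lra]. Qed.

Lemma react_lt (a b p q x y : R) :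
  0 < a -> 0 < b -> 0 < p -> 0 < q -> x < y -> react a b p q x < react a b p q y.
Proof.
  intros Ha Hb Hp Hq H. unfold react.
  assert (exp (p * x) < exp (p * y)) by (apply exp_increasing; nra).
  assert (exp (- q * y) < exp (- q * x)) by (apply exp_increasing; nra).
  nra.
Qed.

Lemma react_le (a b p q x y : R) :
  0 < a -> 0 < b -> 0 < p -> 0 < q -> x <= y -> react a b p q x <= react a b p q y.
Proof. intros Ha Hb Hp Hq [H | ->]; [left; now apply react_lt | lra]. Qed.

(* The problem with its two nonlocal normalising factors named [a] and [b]; [w] is the
   derivative of [u], and the equation is written in divergence form. *)
Record profile (N : nat) (Rad : R) (g : R -> R) (A B p q eps a b : R)
  (u w : R -> R) : Prop := {
  profile_cont : forall x, continuous u x;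
  profile_cont_deriv : forall x, continuous w x;
  profile_deriv : forall r, 0 < r < Rad -> is_derive u r (w r);
  profile_flux : forall r, 0 < r < Rad ->
    is_derive (flux N g w) r (r ^ (N - 1) * react a b p q (u r) / eps ^ 2);
  profile_mean : RInt (fun s => s ^ (N - 1) * u s) 0 Rad = 0;
  profile_a : a * RInt (fun s => s ^ (N - 1) * exp (p * u s)) 0 Rad = Rad ^ N / INR N * A;
  profile_b : b * RInt (fun s => s ^ (N - 1) * exp (- q * u s)) 0 Rad = Rad ^ N / INR N * B;
  profile_end : eps ^ 2 * flux N g w Rad = Rad ^ N / INR N * (A - B) }.

(** * A single solution with B < A *)

Section Radial.

Variables (N : nat) (Rad : R) (g : R -> R) (A B p q gm gM : R).
Hypotheses (HN : (2 <= N)%nat) (HR : 0 < Rad)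
  (Hg : forall x, continuous g x)
  (Hgm : 0 < gm) (Hbd : forall x, 0 <= x <= Rad -> gm <= g x <= gM)
  (HB : 0 < B) (HAB : B < A) (Hp : 0 < p) (Hq : 0 < q).

Lemma INR_dim_pos : 0 < INR N.
Proof. apply lt_0_INR; lia. Qed.

Lemma ball_volume_pos : 0 < Rad ^ N / INR N.
Proof. apply Rdiv_lt_0_compat; [now apply pow_lt | apply INR_dim_pos]. Qed.

(** * Integrals against the radial weight *)

Lemma RInt_radial_weight (x y : R) :
  RInt (fun s => s ^ (N - 1)) x y = y ^ N / INR N - x ^ N / INR N.
Proof.
  apply is_RInt_unique.
  apply (is_RInt_derive (fun s => s ^ N / INR N)).
  - intros s _. auto_derive; [easy |].
    replace (pred N) with (N - 1)%nat by lia. field.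
    pose proof INR_dim_pos; lra.
  - intros s _; apply continuous_pow.
Qed.

Lemma ex_RInt_weighted (f : R -> R) (x y : R) :
  (forall s, continuous f s) -> ex_RInt (fun s => s ^ (N - 1) * f s) x y.
Proof.
  intros Hf. apply (@ex_RInt_continuous R_CompleteNormedModule).
  intros z _. apply continuous_Rmult; [apply continuous_pow | apply Hf].
Qed.

Lemma RInt_weighted_ge (f : R -> R) (k x y : R) :
  0 <= x -> x <= y -> (forall s, continuous f s) -> (forall s, x < s < y -> k <= f s) ->
  (y ^ N / INR N - x ^ N / INR N) * k <= RInt (fun s => s ^ (N - 1) * f s) x y.
Proof.
  intros Hx Hxy Hf Hk.
  rewrite <- RInt_radial_weight, Rmult_comm.
  rewrite <- (RInt_scal (V := R_CompleteNormedModule) (fun s => s ^ (N - 1))).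
  2: { apply (@ex_RInt_continuous R_CompleteNormedModule). intros z _; apply continuous_pow. }
  apply RInt_le; [easy | | now apply ex_RInt_weighted |].
  - apply (@ex_RInt_scal R_CompleteNormedModule).
    apply (@ex_RInt_continuous R_CompleteNormedModule). intros z _; apply continuous_pow.
  - intros s Hs. change (k * s ^ (N - 1) <= s ^ (N - 1) * f s).
    rewrite Rmult_comm. apply Rmult_le_compat_l; [apply pow_le; lra | now apply Hk].
Qed.

Lemma RInt_weighted_le (f : R -> R) (k x y : R) :
  0 <= x -> x <= y -> (forall s, continuous f s) -> (forall s, x < s < y -> f s <= k) ->
  RInt (fun s => s ^ (N - 1) * f s) x y <= (y ^ N / INR N - x ^ N / INR N) * k.
Proof.
  intros Hx Hxy Hf Hk.
  assert (H := RInt_weighted_ge (fun s => - f s) (- k) x y Hx Hxy).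
  rewrite (RInt_ext _ (fun s => opp (s ^ (N - 1) * f s))) in H.
  2: { intros s _. change (s ^ (N - 1) * - f s = - (s ^ (N - 1) * f s)). ring. }
  rewrite (RInt_opp (V := R_CompleteNormedModule)) in H by now apply ex_RInt_weighted.
  change (opp ?z) with (- z) in H.
  enough ((y ^ N / INR N - x ^ N / INR N) * - k <= - RInt (fun s => s ^ (N - 1) * f s) x y) by lra.
  apply H.
  - intros s; apply (continuous_opp f); apply Hf.
  - intros s Hs; specialize (Hk s Hs); lra.
Qed.

Lemma zero_pow_dim (k : nat) : (0 < k)%nat -> 0 ^ k = 0.
Proof. intros; apply pow_i; lia. Qed.

(* Jensen's inequality for the exponential: integrate [1 + k u <= exp (k u)]. *)
Lemma RInt_weighted_exp_ge (u : R -> R) (Hu : forall x, continuous u x)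
  (Hm : RInt (fun s => s ^ (N - 1) * u s) 0 Rad = 0) (k : R) :
  Rad ^ N / INR N <= RInt (fun s => s ^ (N - 1) * exp (k * u s)) 0 Rad.
Proof.
  assert (Hc1 : forall s, continuous (fun _ : R => 1) s) by (intros; apply continuous_const).
  assert (H : RInt (fun s => s ^ (N - 1) + k * (s ^ (N - 1) * u s)) 0 Rad = Rad ^ N / INR N).
  { rewrite (RInt_plus (V := R_CompleteNormedModule)
              (fun s => s ^ (N - 1)) (fun s => scal k (s ^ (N - 1) * u s))).
    - rewrite RInt_radial_weight, (RInt_scal (V := R_CompleteNormedModule)), Hm
        by (apply ex_RInt_weighted, Hu).
      change (Rad ^ N / INR N - 0 ^ N / INR N + k * 0 = Rad ^ N / INR N).
      rewrite zero_pow_dim by lia. unfold Rdiv. ring.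
    - apply (@ex_RInt_continuous R_CompleteNormedModule). intros z _; apply continuous_pow.
    - apply (@ex_RInt_scal R_CompleteNormedModule). apply ex_RInt_weighted, Hu. }
  rewrite <- H. apply RInt_le; [lra | | |].
  - apply (@ex_RInt_continuous R_CompleteNormedModule). intros z _.
    apply (continuous_plus (fun s => s ^ (N - 1)) (fun s => k * (s ^ (N - 1) * u s))).
    + apply continuous_pow.
    + apply continuous_Rmult; [apply continuous_const |].
      apply continuous_Rmult; [apply continuous_pow | apply Hu].
  - apply (ex_RInt_weighted (fun s => exp (k * u s))).
    intros s; apply continuous_exp_scal, Hu.
  - intros s Hs. assert (0 <= s ^ (N - 1)) by (apply pow_le; lra).
    pose proof (exp_ineq1_le (k * u s)). nra.
Qed.

Section Profile.

Variables (eps a b : R) (u w : R -> R).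
Hypotheses (Heps : 0 < eps) (Hsol : profile N Rad g A B p q eps a b u w).

Local Notation phi := (flux N g w).
Local Notation F := (react a b p q).
Local Notation Phi := (react_prim a b p q).
Local Notation V := (Rad ^ N / INR N).
Local Notation Hu := (profile_cont _ _ _ _ _ _ _ _ _ _ _ _ Hsol).
Local Notation Hw := (profile_cont_deriv _ _ _ _ _ _ _ _ _ _ _ _ Hsol).
Local Notation Hmean := (profile_mean _ _ _ _ _ _ _ _ _ _ _ _ Hsol).
Local Notation Hdu := (profile_deriv _ _ _ _ _ _ _ _ _ _ _ _ Hsol).

Lemma profile_a_pos : 0 < a.
Proof.
  assert (H := profile_a _ _ _ _ _ _ _ _ _ _ _ _ Hsol).
  pose proof (RInt_weighted_exp_ge u Hu Hmean p) as HI. pose proof ball_volume_pos as HV.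
  assert (0 < V * A) by (apply Rmult_lt_0_compat; lra). nra.
Qed.

Lemma profile_b_pos : 0 < b.
Proof.
  assert (H := profile_b _ _ _ _ _ _ _ _ _ _ _ _ Hsol).
  pose proof (RInt_weighted_exp_ge u Hu Hmean (- q)) as HI. pose proof ball_volume_pos as HV.
  assert (0 < V * B) by (apply Rmult_lt_0_compat; lra). nra.
Qed.

(** By Jensen the integral that [a] multiplies is at least [Rad^N / N], and the product is [A] times
    that number. *)
Lemma profile_a_le : a <= A.
Proof.
  assert (H := profile_a _ _ _ _ _ _ _ _ _ _ _ _ Hsol).
  pose proof (RInt_weighted_exp_ge u Hu Hmean p) as HI. pose proof ball_volume_pos as HV.
  pose proof profile_a_pos. nra.
Qed.

Lemma profile_b_le : b <= B.
Proof.
  assert (H := profile_b _ _ _ _ _ _ _ _ _ _ _ _ Hsol).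
  pose proof (RInt_weighted_exp_ge u Hu Hmean (- q)) as HI. pose proof ball_volume_pos as HV.
  pose proof profile_b_pos. nra.
Qed.

Local Notation Ha := profile_a_pos.
Local Notation Hb := profile_b_pos.

(** * Signs of the flux and of the reaction, monotonicity *)

Lemma flux_cont (x : R) : continuous phi x.
Proof.
  apply continuous_Rmult; [apply continuous_Rmult |]; [apply continuous_pow | apply Hg | apply Hw].
Qed.

Lemma react_cont (x : R) : continuous (fun s => F (u s)) x.
Proof.
  apply (continuous_comp u F); [apply Hu |].
  apply (@ex_derive_continuous R_AbsRing R_NormedModule). eexists. apply is_derive_react.
Qed.

Lemma flux_deriv (r : R) : 0 < r < Rad -> is_derive phi r (r ^ (N - 1) * F (u r) / eps ^ 2).
Proof. apply (profile_flux _ _ _ _ _ _ _ _ _ _ _ _ Hsol). Qed.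

Lemma flux_zero : phi 0 = 0.
Proof. unfold flux. rewrite zero_pow_dim by lia. ring. Qed.

Lemma eps2_pos : 0 < eps ^ 2.
Proof. now apply pow_lt. Qed.

Lemma flux_end_pos : 0 < phi Rad.
Proof.
  assert (H := profile_end _ _ _ _ _ _ _ _ _ _ _ _ Hsol).
  pose proof ball_volume_pos. pose proof eps2_pos.
  assert (0 < V * (A - B)) by (apply Rmult_lt_0_compat; lra). nra.
Qed.

Lemma weight_pos (r : R) : 0 < r -> 0 < r ^ (N - 1).
Proof. apply pow_lt. Qed.

Lemma deriv_of_flux (r : R) : 0 < r <= Rad -> w r = phi r / (r ^ (N - 1) * g r).
Proof.
  intros Hr. unfold flux. pose proof (weight_pos r (proj1 Hr)).
  destruct (Hbd r); [lra |]. field; lra.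
Qed.

Lemma flux_deriv_sign (r : R) :
  0 < r -> 0 <= r ^ (N - 1) * F (u r) / eps ^ 2 -> 0 <= F (u r).
Proof.
  intros Hr H. pose proof (weight_pos r Hr). pose proof eps2_pos.
  apply Rmult_le_reg_l with (r ^ (N - 1) / eps ^ 2).
  - now apply Rdiv_lt_0_compat.
  - rewrite Rmult_0_r. unfold Rdiv in *. lra.
Qed.

(** Fermat's rule, the weight [r^(N-1)] being positive. It serves twice: for a supposed negative
    minimum of the flux, and for a supposed zero of the flux once it is known to be nonnegative. *)
Lemma flux_min_react (r : R) :
  0 < r < Rad -> (forall s, 0 < s < Rad -> phi r <= phi s) -> F (u r) = 0.
Proof.
  intros Hr Hmin.
  assert (D := flux_deriv r Hr).
  assert (pr : derivable_pt phi r) by (eexists; apply is_derive_Reals; exact D).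
  assert (H := deriv_minimum phi 0 Rad r pr (proj1 Hr) (proj2 Hr)
                 (fun x h1 h2 => Hmin x (conj h1 h2))).
  rewrite Derive_Reals, (is_derive_unique _ _ _ D) in H.
  pose proof (weight_pos r (proj1 Hr)). pose proof eps2_pos.
  apply Rmult_eq_reg_l with (r ^ (N - 1) / eps ^ 2).
  - unfold Rdiv in *. lra.
  - apply Rgt_not_eq, Rdiv_lt_0_compat; assumption.
Qed.

(* At a negative interior minimum of the flux the reaction vanishes while [u] strictly
   decreases, so the flux would go on decreasing. *)
Lemma flux_nonneg (r : R) : 0 <= r <= Rad -> 0 <= phi r.
Proof.
  intros Hr.
  destruct (continuity_ab_min phi 0 Rad) as [m [Hmin Hm]]; [lra | |].
  { intros c _. apply continuity_pt_filterlim, flux_cont. }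
  destruct (Rle_lt_dec 0 (phi m)) as [H | Hneg].
  { apply Rle_trans with (1 := H), Hmin, Hr. }
  exfalso.
  assert (H0 := flux_zero). assert (H1 := flux_end_pos).
  assert (Hm' : 0 < m < Rad).
  { split; (apply Rnot_le_lt; intros ?).
    - replace m with 0 in Hneg by lra. lra.
    - replace m with Rad in Hneg by lra. lra. }
  assert (HF : F (u m) = 0) by (apply flux_min_react; [easy | intros; apply Hmin; lra]).
  assert (Hloc : locally m (fun y => phi y < 0)).
  { apply (flux_cont m (fun z => z < 0)). now apply open_lt. }
  destruct Hloc as [d Hd].
  set (y := m + Rmin (d / 2) ((Rad - m) / 2)).
  assert (Hy : m < y < Rad /\ y < m + d).
  { unfold y. pose proof (cond_pos d).
    pose proof (Rmin_l (d / 2) ((Rad - m) / 2)). pose proof (Rmin_r (d / 2) ((Rad - m) / 2)).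
    assert (0 < Rmin (d / 2) ((Rad - m) / 2)) by (apply Rmin_glb_lt; lra). lra. }
  destruct (mean_value phi (fun r => r ^ (N - 1) * F (u r) / eps ^ 2) m y) as [c [Hc Ec]].
  - lra.
  - intros x Hx; apply flux_deriv; lra.
  - intros; apply flux_cont.
  - assert (phi m <= phi y) by (apply Hmin; lra).
    assert (0 <= F (u c)).
    { apply flux_deriv_sign; [lra |].
      apply Rmult_le_reg_r with (y - m); lra. }
    destruct (mean_value u w m c) as [e [He Ee]].
    + lra.
    + intros; apply Hdu; lra.
    + intros; apply Hu.
    + assert (Hphi : phi e < 0).
      { apply Hd. unfold ball; simpl; unfold AbsRing_ball, abs, minus, plus, opp; simpl.
        rewrite Rabs_right; lra. }
      assert (Hwe : w e < 0).
      { rewrite deriv_of_flux by lra. pose proof (weight_pos e). destruct (Hbd e); [lra |].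
        apply Ropp_lt_cancel. rewrite Ropp_0.
        replace (- (phi e / (e ^ (N - 1) * g e))) with (- phi e / (e ^ (N - 1) * g e))
          by (field; split; nra).
        apply Rdiv_lt_0_compat; [lra |]. apply Rmult_lt_0_compat; lra. }
      assert (u c < u m) by nra.
      pose proof (react_lt a b p q (u c) (u m) Ha Hb Hp Hq). lra.
Qed.

Lemma deriv_nonneg (r : R) : 0 < r <= Rad -> 0 <= w r.
Proof.
  intros Hr. rewrite deriv_of_flux by easy. destruct (Hbd r); [lra |].
  apply Rdiv_le_0_compat; [apply flux_nonneg; lra |].
  apply Rmult_lt_0_compat; [now apply weight_pos | lra].
Qed.

Lemma profile_nondecreasing (r s : R) : 0 <= r -> r <= s -> s <= Rad -> u r <= u s.
Proof.
  intros Hr Hrs Hs. apply (nondecreasing_of_deriv u w); [easy | | |].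
  - intros; apply Hdu; lra.
  - intros; apply Hu.
  - intros; apply deriv_nonneg; lra.
Qed.

(* Gronwall for [phi + (u - u r0)]: a zero of the flux at [r0 > 0] would propagate to [Rad]. *)
Lemma flux_pos (r : R) : 0 < r <= Rad -> 0 < phi r.
Proof.
  intros Hr. destruct (flux_nonneg r) as [H | H]; [lra | easy | exfalso].
  assert (H1 := flux_end_pos).
  assert (Hr' : 0 < r < Rad).
  { split; [lra |]. apply Rnot_le_lt; intros ?. replace r with Rad in H by lra. lra. }
  assert (HF : F (u r) = 0).
  { apply flux_min_react; [easy |]. intros; rewrite <- H; apply flux_nonneg; lra. }
  (* [L] bounds the derivative of the reaction on [[u r, u Rad]], each exponential being taken at
     its worse endpoint. Then [phi' <= c1 (u - u r)] and [u' <= c2 phi], so the sum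
     [phi + (u - u r)] grows at most at rate [c1 + c2]. *)
  set (L := a * p * exp (p * u Rad) + b * q * exp (- q * u r)).
  set (c1 := Rad ^ (N - 1) * L / eps ^ 2).
  set (c2 := / (r ^ (N - 1) * gm)).
  assert (Hap : 0 < a * p) by (apply Rmult_lt_0_compat; [apply Ha | easy]).
  assert (Hbq : 0 < b * q) by (apply Rmult_lt_0_compat; [apply Hb | easy]).
  assert (HL : 0 < L).
  { unfold L. pose proof (exp_pos (p * u Rad)). pose proof (exp_pos (- q * u r)). nra. }
  assert (Hr1 : 0 < r ^ (N - 1)) by (apply weight_pos; lra).
  assert (Hc1 : 0 < c1).
  { apply Rdiv_lt_0_compat; [| apply eps2_pos].
    apply Rmult_lt_0_compat; [now apply pow_lt | easy]. }
  assert (Hc2 : 0 < c2) by (apply Rinv_0_lt_compat, Rmult_lt_0_compat; easy).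
  set (c := c1 + c2).
  assert (Hlip : forall s, r <= s <= Rad -> F (u s) <= L * (u s - u r)).
  { intros s Hs. assert (Hus := profile_nondecreasing r s).
    assert (HuR := profile_nondecreasing s Rad).
    assert (Hrs : u r <= u s) by (apply Hus; lra).
    destruct Hrs as [Hrs | <-]; [| rewrite HF; lra].
    destruct (mean_value F (fun y => a * p * exp (p * y) + b * q * exp (- q * y)) (u r) (u s))
      as [y [Hy Ey]]; auto.
    - intros; apply is_derive_react.
    - intros; apply (@ex_derive_continuous R_AbsRing R_NormedModule); eexists; apply is_derive_react.
    - rewrite HF in Ey. replace (F (u s)) with (F (u s) - 0) by ring. rewrite Ey.
      apply Rmult_le_compat_r; [lra |]. unfold L.
      assert (exp (p * y) <= exp (p * u Rad)).
      { assert (p * y <= p * u Rad) by (apply Rmult_le_compat_l; lra).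
        destruct H0 as [H0 | ->]; [left; now apply exp_increasing | apply Rle_refl]. }
      assert (exp (- q * y) <= exp (- q * u r)) by (left; apply exp_increasing; nra).
      apply Rplus_le_compat; (apply Rmult_le_compat_l; [lra | easy]). }
  (* The sum times [e^(-cs)] is nonincreasing, hence the minus sign. It vanishes at [r] but is
     positive at [Rad], a contradiction. *)
  assert (HG := nondecreasing_of_deriv
    (fun s => - ((phi s + (u s - u r)) * exp (- c * s)))
    (fun s => - ((s ^ (N - 1) * F (u s) / eps ^ 2 + w s) * exp (- c * s)
                 - c * (phi s + (u s - u r)) * exp (- c * s))) r Rad).
  cbv beta in HG.
  assert (HG' : - ((phi r + (u r - u r)) * exp (- c * r)) <=
     - ((phi Rad + (u Rad - u r)) * exp (- c * Rad))).
  { apply HG.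
    - lra.
    - intros x Hx. assert (D1 := flux_deriv x). assert (D2 := Hdu x).
      auto_derive.
      + split; [eexists; apply D1; lra |]. split; [eexists; apply D2; lra | easy].
      + rewrite (Derive_eta _ _ _ (D1 ltac:(lra))), (Derive_eta _ _ _ (D2 ltac:(lra))).
        ring.
    - intros x _.
      apply (continuous_opp (fun s => (phi s + (u s - u r)) * exp (- c * s))).
      apply continuous_Rmult.
      + apply (continuous_plus phi (fun s => u s - u r)); [apply flux_cont |].
        apply (continuous_minus u (fun _ => u r)); [apply Hu | apply continuous_const].
      + apply continuous_exp_scal, continuous_id.
    - intros x Hx. set (E := exp (- c * x)). assert (HE : 0 < E) by apply exp_pos.
      assert (Hphi : 0 <= phi x) by (apply flux_nonneg; lra).
      assert (Hux : u r <= u x) by (apply profile_nondecreasing; lra).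
      assert (K1 : x ^ (N - 1) * F (u x) / eps ^ 2 <= c1 * (u x - u r)).
      { unfold c1. pose proof eps2_pos.
        replace (Rad ^ (N - 1) * L / eps ^ 2 * (u x - u r))
          with (Rad ^ (N - 1) * (L * (u x - u r)) / eps ^ 2) by (field; lra).
        apply Rmult_le_compat_r; [left; now apply Rinv_0_lt_compat |].
        apply Rle_trans with (x ^ (N - 1) * (L * (u x - u r))).
        - apply Rmult_le_compat_l; [apply pow_le; lra | apply Hlip; lra].
        - apply Rmult_le_compat_r; [nra | apply pow_incr; lra]. }
      assert (K2 : w x <= c2 * phi x).
      { rewrite deriv_of_flux by lra. unfold c2, Rdiv. rewrite Rmult_comm.
        apply Rmult_le_compat_r; [easy |]. destruct (Hbd x); [lra |].
        apply Rinv_le_contravar; [now apply Rmult_lt_0_compat |].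
        apply Rmult_le_compat; [lra | lra | apply pow_incr; lra | lra]. }
      unfold c.
      assert (0 <= c1 * phi x) by (apply Rmult_le_pos; lra).
      assert (0 <= c2 * (u x - u r)) by (apply Rmult_le_pos; lra).
      nra. }
  assert (0 < exp (- c * Rad)) by apply exp_pos.
  assert (u r <= u Rad) by (apply profile_nondecreasing; lra).
  rewrite <- H in HG'. nra.
Qed.

Lemma profile_increasing (r s : R) : 0 <= r -> r < s -> s <= Rad -> u r < u s.
Proof.
  intros Hr Hrs Hs.
  destruct (mean_value u w r s) as [c [Hc Ec]]; [easy | | |].
  { intros; apply Hdu; lra. }
  { intros; apply Hu. }
  assert (0 < w c).
  { rewrite deriv_of_flux by lra. destruct (Hbd c); [lra |].
    apply Rdiv_lt_0_compat; [apply flux_pos; lra |].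
    apply Rmult_lt_0_compat; [apply weight_pos; lra | lra]. }
  nra.
Qed.

(** The flux rises from 0 at the centre to a positive value at [r], so the reaction is nonnegative
    somewhere in [(0, r)], and [F] and [u] are both nondecreasing. At the centre itself a negative
    value would persist nearby by continuity. *)
Lemma react_nonneg (r : R) : 0 <= r <= Rad -> 0 <= F (u r).
Proof.
  assert (Hpos : forall r, 0 < r <= Rad -> 0 <= F (u r)).
  { clear r; intros r Hr.
    destruct (mean_value phi (fun r => r ^ (N - 1) * F (u r) / eps ^ 2) 0 r) as [c [Hc Ec]].
    - lra.
    - intros; apply flux_deriv; lra.
    - intros; apply flux_cont.
    - rewrite flux_zero in Ec. pose proof (flux_pos r Hr).
      assert (0 <= F (u c)).
      { apply flux_deriv_sign; [lra |]. apply Rmult_le_reg_r with (r - 0); lra. }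
      apply Rle_trans with (1 := H0). apply react_le; auto using profile_a_pos, profile_b_pos.
      apply profile_nondecreasing; lra. }
  intros [[Hr | <-] Hr']; [now apply Hpos |].
  apply Rnot_lt_le; intros Hlt.
  assert (Hloc : locally 0 (fun y => F (u y) < 0)).
  { apply (react_cont 0 (fun z => z < 0)). now apply open_lt. }
  destruct Hloc as [d Hd]. pose proof (cond_pos d) as Hd0.
  set (y := Rmin (d / 2) Rad).
  assert (Hy : 0 < y <= Rad /\ y < d).
  { unfold y. pose proof (Rmin_l (d / 2) Rad). pose proof (Rmin_r (d / 2) Rad).
    assert (0 < Rmin (d / 2) Rad) by (apply Rmin_glb_lt; lra). lra. }
  assert (F (u y) < 0).
  { apply Hd. unfold ball; simpl; unfold AbsRing_ball, abs, minus, plus, opp; simpl.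
    rewrite Rabs_right; lra. }
  pose proof (Hpos y). lra.
Qed.

Lemma profile_zero_nonpos : u 0 <= 0.
Proof.
  assert (Hm := profile_mean _ _ _ _ _ _ _ _ _ _ _ _ Hsol).
  assert (H := RInt_weighted_ge u (u 0) 0 Rad (Rle_refl 0) (Rlt_le _ _ HR) Hu).
  rewrite Hm, zero_pow_dim in H by lia. pose proof ball_volume_pos.
  assert (H' : (V - 0 / INR N) * u 0 <= 0).
  { apply H. intros; apply profile_nondecreasing; lra. }
  unfold Rdiv in H'. rewrite Rmult_0_l, Rminus_0_r in H'. nra.
Qed.

(** As [u] increases, [e^(-qu)] is largest at the centre, and the integral that defines [b] is at
    most [Rad^N / N] times this maximum. *)
Lemma b_exp_ge : B <= b * exp (- q * u 0).
Proof.
  assert (H := profile_b _ _ _ _ _ _ _ _ _ _ _ _ Hsol).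
  assert (HI := RInt_weighted_le (fun s => exp (- q * u s)) (exp (- q * u 0)) 0 Rad
                 (Rle_refl 0) (Rlt_le _ _ HR)).
  rewrite zero_pow_dim in HI by lia.
  assert (HI' : RInt (fun s => s ^ (N - 1) * exp (- q * u s)) 0 Rad
                <= (V - 0 / INR N) * exp (- q * u 0)).
  { apply HI.
    - intros; apply continuous_exp_scal, Hu.
    - intros s Hs. assert (u 0 < u s) by (apply profile_increasing; lra).
      left; apply exp_increasing; nra. }
  replace (V - 0 / INR N) with V in HI' by (unfold Rdiv; ring).
  pose proof ball_volume_pos.
  apply Rmult_le_reg_l with V; [easy |]. rewrite <- H.
  replace (V * (b * exp (- q * u 0))) with (b * (V * exp (- q * u 0))) by ring.
  apply Rmult_le_compat_l; [left; apply Hb | easy].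
Qed.

Lemma a_exp_ge : B <= a * exp (p * u 0).
Proof.
  pose proof (react_nonneg 0) as H. pose proof b_exp_ge. unfold react in H. lra.
Qed.

Lemma a_ge : B <= a.
Proof.
  pose proof a_exp_ge. pose proof profile_zero_nonpos. pose proof profile_a_pos.
  assert (exp (p * u 0) <= 1).
  { rewrite <- exp_0. destruct H0 as [H0 | ->]; [left; apply exp_increasing; nra |].
    rewrite Rmult_0_r; lra. }
  nra.
Qed.

(** [B <= a e^(p u(0))] and [a <= A] combine into a lower bound for [u] that does not depend on
    [eps]. *)
Lemma profile_zero_ge : - (ln (A / B) / p) <= u 0.
Proof.
  assert (H : B / A <= exp (p * u 0)).
  { pose proof a_exp_ge. pose proof profile_a_le. pose proof (exp_pos (p * u 0)).
    apply Rmult_le_reg_l with A; [lra |]. replace (A * (B / A)) with B by (field; lra). nra. }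
  assert (H' : ln (B / A) <= p * u 0).
  { rewrite <- (ln_exp (p * u 0)). apply ln_le; [apply Rdiv_lt_0_compat; lra | easy]. }
  replace (B / A) with (/ (A / B)) in H' by (field; lra).
  rewrite ln_Rinv in H' by (apply Rdiv_lt_0_compat; lra).
  apply Rmult_le_reg_l with p; [easy |].
  replace (p * - (ln (A / B) / p)) with (- ln (A / B)) by (field; lra). easy.
Qed.

(** Above [u 0] the derivative of [F] is at least [p a e^(p u(0)) >= p B]. This turns smallness of
    the reaction into closeness of [u] to its central value. *)
Lemma react_slope (y : R) : u 0 <= y -> p * B * (y - u 0) <= F y.
Proof.
  intros [Hy | <-].
  - destruct (mean_value F (fun y => a * p * exp (p * y) + b * q * exp (- q * y)) (u 0) y)
      as [c [Hc Ec]]; auto.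
    + intros; apply is_derive_react.
    + intros; apply (@ex_derive_continuous R_AbsRing R_NormedModule); eexists; apply is_derive_react.
    + pose proof (react_nonneg 0). pose proof a_exp_ge. pose proof profile_a_pos.
      assert (exp (p * u 0) < exp (p * c)) by (apply exp_increasing; nra).
      pose proof (exp_pos (- q * c)).
      assert (p * B <= a * p * exp (p * c) + b * q * exp (- q * c)).
      { assert (0 < b * q) by (apply Rmult_lt_0_compat; [apply Hb | easy]).
        assert (B <= a * exp (p * c)) by nra. nra. }
      nra.
  - pose proof (react_nonneg 0). lra.
Qed.

(* [phi'' >= (lam/eps)^2 phi], hence [phi' >= (lam/eps) phi], hence exponential decay away
   from the boundary. *)
Lemma flux_decay (lam r : R) :
  0 < lam -> lam ^ 2 * gM <= p * B -> 0 <= r <= Rad ->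
  phi r <= phi Rad * exp (- (lam / eps) * (Rad - r)).
Proof.
  intros Hlam Hlam2 Hr. set (k := lam / eps).
  assert (Hk : 0 < k) by now apply Rdiv_lt_0_compat.
  pose proof eps2_pos as He2.
  assert (Hz : forall x, 0 <= x <= Rad -> k * phi x <= x ^ (N - 1) * F (u x) / eps ^ 2).
  { intros x Hx.
    (* The product [(phi' - k phi) e^(ks)] has derivative [(phi'' - k^2 phi) e^(ks)]. It vanishes at
       0 because [N >= 2] makes the weight vanish there. *)
    assert (HG := nondecreasing_of_deriv
      (fun s => (s ^ (N - 1) * F (u s) / eps ^ 2 - k * phi s) * exp (k * s))
      (fun s => (INR (N - 1) * s ^ (N - 1 - 1) * F (u s) / eps ^ 2
           + s ^ (N - 1) * ((a * p * exp (p * u s) + b * q * exp (- q * u s)) * w s) / eps ^ 2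
           - k ^ 2 * phi s) * exp (k * s)) 0 x).
    cbv beta in HG.
    rewrite flux_zero, zero_pow_dim in HG by lia.
    assert (HG' : (0 * F (u 0) / eps ^ 2 - k * 0) * exp (k * 0) <=
       (x ^ (N - 1) * F (u x) / eps ^ 2 - k * phi x) * exp (k * x)).
    { apply HG.
      - lra.
      - intros s Hs.
        assert (D1 := flux_deriv s ltac:(lra)). assert (D2 := Hdu s ltac:(lra)).
        assert (D3 := is_derive_react a b p q (u s)).
        auto_derive.
        + repeat split; eexists; eauto.
        + rewrite (Derive_eta _ _ _ D1), (Derive_eta _ _ _ D2),
            (Derive_eta _ _ _ D3).
          replace (Init.Nat.pred (N - 1)) with (N - 1 - 1)%nat by lia.
          field. lra.
      - intros s _. apply continuous_Rmult.
        + apply (continuous_minus (fun s => s ^ (N - 1) * F (u s) / eps ^ 2) (fun s => k * phi s)).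
          * apply continuous_Rmult; [| apply continuous_const].
            apply continuous_Rmult; [apply continuous_pow | apply react_cont].
          * apply continuous_Rmult; [apply continuous_const | apply flux_cont].
        + apply continuous_exp_scal, continuous_id.
      - intros s Hs. apply Rmult_le_pos; [| left; apply exp_pos].
        assert (HF : 0 <= F (u s)) by (apply react_nonneg; lra).
        assert (Hphi : 0 <= phi s) by (apply flux_nonneg; lra).
        rewrite deriv_of_flux by lra. destruct (Hbd s) as [Hg1 Hg2]; [lra |].
        assert (Hs1 : 0 < s ^ (N - 1)) by (apply weight_pos; lra).
        set (S := a * p * exp (p * u s) + b * q * exp (- q * u s)).
        assert (HS : p * B <= S).
        { unfold S. pose proof a_exp_ge. pose proof profile_a_pos. pose proof (exp_pos (- q * u s)).
          assert (u 0 < u s) by (apply profile_increasing; lra).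
          assert (exp (p * u 0) < exp (p * u s)) by (apply exp_increasing; nra).
          assert (0 < b * q) by (apply Rmult_lt_0_compat; [apply Hb | easy]).
          assert (B <= a * exp (p * u s)) by nra. nra. }
        (* The part of [phi''] that comes from differentiating the weight has a good sign and is
           dropped. In the other part [u' = phi / (s^(N-1) g)] cancels the weight and leaves the
           coefficient [S / (g eps^2)], which is at least [k^2] because [lam^2 gM <= p B]. *)
        assert (H1 : 0 <= INR (N - 1) * s ^ (N - 1 - 1) * F (u s) / eps ^ 2).
        { apply Rdiv_le_0_compat; [| easy]. apply Rmult_le_pos; [| easy].
          apply Rmult_le_pos; [apply pos_INR | apply pow_le; lra]. }
        replace (s ^ (N - 1) * (S * (phi s / (s ^ (N - 1) * g s))) / eps ^ 2)
          with (S / g s / eps ^ 2 * phi s) by (field; lra).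
        assert (H2 : k ^ 2 <= S / g s / eps ^ 2).
        { unfold k. replace ((lam / eps) ^ 2) with (lam ^ 2 / eps ^ 2) by (field; lra).
          apply Rmult_le_compat_r; [left; now apply Rinv_0_lt_compat |].
          apply Rmult_le_reg_r with (g s); [lra |].
          replace (S / g s * g s) with S by (field; lra).
          assert (0 < lam ^ 2) by now apply pow_lt. nra. }
        assert (k ^ 2 * phi s <= S / g s / eps ^ 2 * phi s) by (apply Rmult_le_compat_r; easy).
        lra. }
    pose proof (exp_pos (k * x)).
    apply Rmult_le_reg_r with (exp (k * x)); [easy |]. unfold Rdiv in *. nra. }
  (* [phi' >= k phi] is now integrated from [r] to the boundary. *)
  assert (HG := nondecreasing_of_deriv (fun s => phi s * exp (- k * s))
      (fun s => (s ^ (N - 1) * F (u s) / eps ^ 2 - k * phi s) * exp (- k * s)) r Rad).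
  cbv beta in HG.
  assert (HG' : phi r * exp (- k * r) <= phi Rad * exp (- k * Rad)).
  { apply HG.
    - lra.
    - intros s Hs. assert (D1 := flux_deriv s ltac:(lra)). auto_derive.
      + eexists; eassumption.
      + rewrite (Derive_eta _ _ _ D1). field; lra.
    - intros s _. apply continuous_Rmult; [apply flux_cont |].
      apply continuous_exp_scal, continuous_id.
    - intros s Hs. apply Rmult_le_pos; [| left; apply exp_pos].
      pose proof (Hz s). lra. }
  replace (- k * (Rad - r)) with (- k * Rad + k * r) by ring.
  rewrite exp_plus. pose proof (exp_pos (k * r)).
  apply Rmult_le_reg_r with (exp (- k * r)); [apply exp_pos |].
  rewrite !Rmult_assoc, <- exp_plus.
  replace (k * r + - k * r) with 0 by ring. rewrite exp_0, Rmult_1_r. easy.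
Qed.

(** Decay passes from the flux to its derivative. On the first half of [[r, Rad]] the reaction is at
    least [F (u r)], so the flux at the midpoint dominates it, and the midpoint still has distance
    [(Rad - r) / 2] to the boundary. The powers of [eps] cancel since [eps^2 phi(Rad)] is fixed. *)
Lemma react_decay (lam r : R) :
  0 < lam -> lam ^ 2 * gM <= p * B -> 0 < r < Rad ->
  F (u r) * (r ^ (N - 1) * ((Rad - r) / 2)) <=
  V * (A - B) * exp (- (lam / eps) * ((Rad - r) / 2)).
Proof.
  intros Hlam Hlam2 Hr. set (d := (Rad - r) / 2).
  assert (Hd : 0 < d) by (unfold d; lra). assert (Hrd : r + d = Rad - d) by (unfold d; lra).
  pose proof eps2_pos as He2.
  destruct (mean_value phi (fun r => r ^ (N - 1) * F (u r) / eps ^ 2) r (r + d)) as [c [Hc Ec]].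
  - lra.
  - intros; apply flux_deriv; lra.
  - intros; apply flux_cont.
  - assert (H1 := flux_decay lam (r + d) Hlam Hlam2 ltac:(lra)).
    assert (H2 := flux_nonneg r ltac:(lra)).
    replace (Rad - (r + d)) with d in H1 by lra.
    assert (HE := profile_end _ _ _ _ _ _ _ _ _ _ _ _ Hsol).
    rewrite <- HE, Rmult_assoc.
    apply Rle_trans with (eps ^ 2 * phi (r + d)); [| apply Rmult_le_compat_l; lra].
    apply Rle_trans with (eps ^ 2 * (c ^ (N - 1) * F (u c) / eps ^ 2 * (r + d - r))).
    + replace (eps ^ 2 * (c ^ (N - 1) * F (u c) / eps ^ 2 * (r + d - r)))
        with (F (u c) * (c ^ (N - 1) * d)) by (field; lra).
      apply Rmult_le_compat.
      * apply react_nonneg; lra.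
      * apply Rmult_le_pos; [apply pow_le; lra | lra].
      * apply react_le; auto using profile_a_pos, profile_b_pos. apply profile_nondecreasing; lra.
      * apply Rmult_le_compat_r; [lra | apply pow_incr; lra].
    + apply Rmult_le_compat_l; lra.
Qed.

(** [(eps^2 phi^2 / 2)'] equals [s^(2(N-1)) g F(u) u'], and [F(u) u' >= 0]. Replacing the variable
    coefficient by a constant [H] therefore gives an inequality, after which the right side
    integrates to a difference of [Phi]. The sign [c] lets one argument serve upper and lower
    bounds. *)
Lemma energy_compare (c H r0 r : R) :
  0 <= r0 -> r0 <= r -> r <= Rad ->
  (forall s, r0 < s < r -> 0 <= c * ((s ^ (N - 1)) ^ 2 * g s - H)) ->
  c * (H * (Phi (u r) - Phi (u r0))) <=
  c * (eps ^ 2 * phi r ^ 2 / 2 - eps ^ 2 * phi r0 ^ 2 / 2).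
Proof.
  intros H0 H1 H2 Hh. pose proof eps2_pos as He2.
  assert (HG := nondecreasing_of_deriv
     (fun s => c * (eps ^ 2 * phi s ^ 2 / 2 - H * Phi (u s)))
     (fun s => c * ((s ^ (N - 1)) ^ 2 * g s - H) * (F (u s) * w s)) r0 r).
  cbv beta in HG.
  enough (c * (eps ^ 2 * phi r0 ^ 2 / 2 - H * Phi (u r0))
          <= c * (eps ^ 2 * phi r ^ 2 / 2 - H * Phi (u r))) by lra.
  apply HG; auto.
  - intros s Hs. assert (D1 := flux_deriv s ltac:(lra)). assert (D2 := Hdu s ltac:(lra)).
    assert (D3 := is_derive_react_prim a b p q (u s) Hp Hq).
    auto_derive.
    + repeat split; eexists; eassumption.
    + rewrite (Derive_eta _ _ _ D1), (Derive_eta _ _ _ D2), (Derive_eta _ _ _ D3).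
      unfold flux. field. lra.
  - intros s _. apply continuous_Rmult; [apply continuous_const |].
    apply (continuous_minus (fun s => eps ^ 2 * phi s ^ 2 / 2) (fun s => H * Phi (u s))).
    + apply continuous_Rmult; [| apply continuous_const].
      apply continuous_Rmult; [apply continuous_const |].
      apply (continuous_comp phi (fun z => z ^ 2)); [apply flux_cont | apply continuous_pow].
    + apply continuous_Rmult; [apply continuous_const |].
      apply (continuous_comp u Phi); [apply Hu |].
      apply (@ex_derive_continuous R_AbsRing R_NormedModule).
      eexists; now apply is_derive_react_prim.
  - intros s Hs. apply Rmult_le_pos; [now apply Hh |].
    apply Rmult_le_pos; [apply react_nonneg; lra |].
    apply deriv_nonneg; lra.
Qed.

Lemma energy_le (H r0 r : R) :
  0 <= r0 -> r0 <= r -> r <= Rad ->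
  (forall s, r0 < s < r -> (s ^ (N - 1)) ^ 2 * g s <= H) ->
  eps ^ 2 * phi r ^ 2 / 2 - eps ^ 2 * phi r0 ^ 2 / 2 <= H * (Phi (u r) - Phi (u r0)).
Proof.
  intros H0 H1 H2 Hh. assert (E := energy_compare (-1) H r0 r H0 H1 H2).
  assert (E' := E ltac:(intros s Hs; specialize (Hh s Hs); lra)). lra.
Qed.

Lemma energy_ge (H r0 r : R) :
  0 <= r0 -> r0 <= r -> r <= Rad ->
  (forall s, r0 < s < r -> H <= (s ^ (N - 1)) ^ 2 * g s) ->
  H * (Phi (u r) - Phi (u r0)) <= eps ^ 2 * phi r ^ 2 / 2 - eps ^ 2 * phi r0 ^ 2 / 2.
Proof.
  intros H0 H1 H2 Hh. assert (E := energy_compare 1 H r0 r H0 H1 H2).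
  assert (E' := E ltac:(intros s Hs; specialize (Hh s Hs); lra)). lra.
Qed.

(** * Consequences of the zero mean and of the boundary condition *)

Lemma profile_end_nonneg : 0 <= u Rad.
Proof.
  assert (Hm := profile_mean _ _ _ _ _ _ _ _ _ _ _ _ Hsol).
  assert (H := RInt_weighted_le u (u Rad) 0 Rad (Rle_refl 0) (Rlt_le _ _ HR) Hu
                 ltac:(intros; apply profile_nondecreasing; lra)).
  rewrite Hm, zero_pow_dim in H by lia.
  replace (V - 0 / INR N) with V in H by (unfold Rdiv; ring).
  pose proof ball_volume_pos. nra.
Qed.

(** Balance of masses: the integral over [[0, r]] is at most [u r] times its volume factor, and the
    integral over [[r, Rad]], which compensates it, is at most [u Rad] times a volume factor of
    order [Rad - r]. An upper bound at the boundary thus yields a lower bound inside. *)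
Lemma profile_lower_mean (r : R) :
  0 < r < Rad -> - u r * (r ^ N / INR N) <= u Rad * (Rad ^ (N - 1) * (Rad - r)).
Proof.
  intros Hr. assert (Hm := profile_mean _ _ _ _ _ _ _ _ _ _ _ _ Hsol).
  rewrite <- (RInt_Chasles (V := R_CompleteNormedModule) _ 0 r Rad) in Hm
    by (apply ex_RInt_weighted, Hu).
  change (plus ?x ?y) with (x + y) in Hm.
  assert (H1 := RInt_weighted_le u (u r) 0 r (Rle_refl 0) ltac:(lra) Hu
                  ltac:(intros; apply profile_nondecreasing; lra)).
  assert (H2 := RInt_weighted_le u (u Rad) r Rad ltac:(lra) ltac:(lra) Hu
                  ltac:(intros; apply profile_nondecreasing; lra)).
  rewrite zero_pow_dim in H1 by lia.
  replace (r ^ N / INR N - 0 / INR N) with (r ^ N / INR N) in H1 by (unfold Rdiv; ring).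
  apply Rle_trans with (u Rad * (V - r ^ N / INR N)); [lra |].
  apply Rmult_le_compat_l; [apply profile_end_nonneg |].
  destruct (mean_value (fun s => s ^ N / INR N) (fun s => s ^ (N - 1)) r Rad) as [c [Hc Ec]].
  - lra.
  - intros s _. auto_derive; [easy |].
    replace (pred N) with (N - 1)%nat by lia. field.
    pose proof INR_dim_pos; lra.
  - intros s _. apply continuous_Rmult; [apply continuous_pow | apply continuous_const].
  - rewrite Ec. apply Rmult_le_compat_r; [lra | apply pow_incr; lra].
Qed.

Lemma flux_end : phi Rad = V * (A - B) / eps ^ 2.
Proof.
  assert (H := profile_end _ _ _ _ _ _ _ _ _ _ _ _ Hsol). rewrite <- H.
  pose proof eps2_pos. field. lra.
Qed.

Lemma deriv_end : eps ^ 2 * w Rad = Rad * (A - B) / (INR N * g Rad).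
Proof.
  assert (H := flux_end). pose proof eps2_pos. pose proof INR_dim_pos.
  rewrite deriv_of_flux, H by lra. destruct (Hbd Rad); [lra |].
  pose proof (weight_pos Rad HR).
  replace (Rad ^ N) with (Rad * Rad ^ (N - 1)) by (rewrite tech_pow_Rmult; f_equal; lia).
  field. lra.
Qed.

End Profile.

(** * The limit of vanishing eps *)

Variables (av bv : R -> R) (U W : R -> R -> R).
Hypothesis Hsol : forall eps, 0 < eps ->
  profile N Rad g A B p q eps (av eps) (bv eps) (U eps) (W eps).

Local Notation F eps := (react (av eps) (bv eps) p q).
Local Notation Phi eps := (react_prim (av eps) (bv eps) p q).
Local Notation phi eps := (flux N g (W eps)).
Local Notation P := (Rad ^ N / INR N * (A - B)).
Local Notation K := (ln (A / B) / p).
Local Notation lam0 := (sqrt (p * B / gM)).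
Local Notation at_eps lem He := (lem _ _ _ _ _ He (Hsol _ He)).

Lemma gM_pos : 0 < gM.
Proof. destruct (Hbd 0); lra. Qed.

Lemma lam0_pos : 0 < lam0.
Proof.
  apply sqrt_lt_R0, Rdiv_lt_0_compat; [| apply gM_pos]. now apply Rmult_lt_0_compat.
Qed.

Lemma lam0_sqr : lam0 ^ 2 * gM <= p * B.
Proof.
  pose proof gM_pos. assert (0 < p * B) by now apply Rmult_lt_0_compat.
  rewrite pow2_sqrt by (apply Rdiv_le_0_compat; lra).
  right. field. lra.
Qed.

Lemma end_flux_const_pos : 0 < P.
Proof. apply Rmult_lt_0_compat; [apply ball_volume_pos | lra]. Qed.

(** * Interior estimates uniform in [eps] *)

Lemma family_nondecreasing (eps r s : R) :
  0 < eps -> 0 <= r -> r <= s -> s <= Rad -> U eps r <= U eps s.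
Proof. intros He. apply (at_eps profile_nondecreasing He). Qed.

Lemma family_zero_bounds (eps : R) : 0 < eps -> - K <= U eps 0 <= 0.
Proof.
  intros He. split; [apply (at_eps profile_zero_ge He) | apply (at_eps profile_zero_nonpos He)].
Qed.

Lemma family_ge (eps r : R) : 0 < eps -> 0 <= r <= Rad -> - K <= U eps r.
Proof.
  intros He Hr. apply Rle_trans with (U eps 0); [now apply family_zero_bounds |].
  apply family_nondecreasing; lra.
Qed.

Lemma coeff_bounds (eps : R) :
  0 < eps -> (0 < av eps /\ B <= av eps <= A) /\ 0 < bv eps <= B.
Proof.
  intros He. assert (H1 := at_eps a_ge He).
  assert (H2 := profile_a_le _ _ _ _ _ (Hsol _ He)).
  assert (H3 := profile_b_pos _ _ _ _ _ (Hsol _ He)).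
  assert (H4 := profile_b_le _ _ _ _ _ (Hsol _ He)). lra.
Qed.

(** At a fixed distance from the boundary the crude [e^(-x) <= 1/x] already extracts a factor [eps]
    from the exponential decay. *)
Lemma interior_gap (d : R) : 0 < d < Rad ->
  exists C, 0 < C /\ forall eps, 0 < eps ->
    F eps (U eps (Rad - d)) <= C * eps /\ U eps (Rad - d) <= C * eps.
Proof.
  intros Hd. pose proof INR_dim_pos as HN0. pose proof end_flux_const_pos as HP.
  pose proof lam0_pos as Hl.
  set (k := (Rad - d) ^ (N - 1) * (d / 2)).
  assert (Hk : 0 < k) by (apply Rmult_lt_0_compat; [apply pow_lt; lra | lra]).
  set (C1 := P / k * (2 / (lam0 * d))).
  assert (HC1 : 0 < C1).
  { apply Rmult_lt_0_compat; apply Rdiv_lt_0_compat; try lra.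
    now apply Rmult_lt_0_compat. }
  assert (HpB : 0 < p * B) by now apply Rmult_lt_0_compat.
  exists (C1 + C1 / (p * B)).
  assert (HC2 : 0 < C1 / (p * B)) by now apply Rdiv_lt_0_compat.
  split; [lra |]. intros eps He.
  assert (H := at_eps react_decay He lam0 (Rad - d) lam0_pos lam0_sqr ltac:(lra)).
  replace (Rad - (Rad - d)) with d in H by ring. fold k in H.
  assert (HE : exp (- (lam0 / eps) * (d / 2)) <= 2 / (lam0 * d) * eps).
  { set (x := lam0 / eps * (d / 2)).
    assert (Hx : 0 < x) by (apply Rmult_lt_0_compat; [now apply Rdiv_lt_0_compat | lra]).
    replace (- (lam0 / eps) * (d / 2)) with (- x) by (unfold x; ring).
    replace (2 / (lam0 * d) * eps) with (/ x) by (unfold x; field; lra).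
    rewrite exp_Ropp. apply Rinv_le_contravar; [easy |].
    pose proof (exp_ineq1_le x). lra. }
  assert (HF : F eps (U eps (Rad - d)) <= C1 * eps).
  { apply Rmult_le_reg_r with k; [easy |]. apply Rle_trans with (1 := H).
    replace (C1 * eps * k) with (P * (2 / (lam0 * d) * eps)) by (unfold C1; field; lra).
    apply Rmult_le_compat_l; lra. }
  split.
  - assert (0 < C1 / (p * B) * eps) by now apply Rmult_lt_0_compat. lra.
  - assert (H1 := at_eps react_slope He (U eps (Rad - d)) ltac:(apply family_nondecreasing; lra)).
    destruct (family_zero_bounds eps He) as [_ H0].
    assert (0 < C1 * eps) by now apply Rmult_lt_0_compat.
    assert (U eps (Rad - d) - U eps 0 <= C1 / (p * B) * eps).
    { apply Rmult_le_reg_l with (p * B); [easy |].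
      replace (p * B * (C1 / (p * B) * eps)) with (C1 * eps) by (field; lra). lra. }
    lra.
Qed.

(* The lower bound [- K] of [u] turns the [exp (- q u)] term into a multiple of [exp (p u)]. *)
Lemma prim_bounds (eps r : R) : 0 < eps -> 0 <= r <= Rad ->
  B / p * exp (p * U eps r) <= Phi eps (U eps r) /\
  Phi eps (U eps r) <= (A / p + B / q * exp ((p + q) * K)) * exp (p * U eps r).
Proof.
  intros He Hr. destruct (coeff_bounds eps He) as [[Ha [Ha1 Ha2]] [Hb Hb1]].
  assert (HK := family_ge eps r He Hr).
  pose proof (exp_pos (p * U eps r)). pose proof (exp_pos (- q * U eps r)).
  unfold react_prim. split.
  - assert (0 < bv eps / q) by now apply Rdiv_lt_0_compat.
    assert (B / p <= av eps / p) by (apply Rmult_le_compat_r; [left; now apply Rinv_0_lt_compat | easy]).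
    nra.
  - rewrite Rmult_plus_distr_r, Rmult_assoc, <- exp_plus.
    apply Rplus_le_compat.
    + apply Rmult_le_compat_r; [lra |].
      apply Rmult_le_compat_r; [left; now apply Rinv_0_lt_compat | easy].
    + apply Rmult_le_compat.
      * left; now apply Rdiv_lt_0_compat.
      * lra.
      * apply Rmult_le_compat_r; [left; now apply Rinv_0_lt_compat | easy].
      * apply exp_mono_le.
        assert (0 <= (p + q) * (K + U eps r)) by (apply Rmult_le_pos; lra). lra.
Qed.

Lemma prim_const_pos : 0 < A / p + B / q * exp ((p + q) * K).
Proof.
  apply Rplus_lt_0_compat; [apply Rdiv_lt_0_compat; lra |].
  apply Rmult_lt_0_compat; [now apply Rdiv_lt_0_compat | apply exp_pos].
Qed.

(** Controls the terms that an energy comparison started at [Rad - d] leaves at its lower end. For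
    the flux, [e^(-x) <= 1/x] with [x = lam0 d / eps] reduces [P / eps^2] to [C2 / eps]. *)
Lemma interior_prim_bound (d : R) : 0 < d < Rad ->
  exists C, 0 < C /\ forall eps, 0 < eps <= 1 ->
    0 <= Phi eps (U eps (Rad - d)) <= C /\ eps ^ 2 * phi eps (Rad - d) ^ 2 <= C.
Proof.
  intros Hd. destruct (interior_gap d Hd) as [C1 [HC1 H1]].
  pose proof prim_const_pos as HCP. set (CP := A / p + B / q * exp ((p + q) * K)) in *.
  pose proof INR_dim_pos as HN0. pose proof end_flux_const_pos as HP.
  pose proof lam0_pos as Hl.
  set (C2 := P / (lam0 * d)).
  assert (HC2 : 0 < C2) by (apply Rdiv_lt_0_compat; [easy | apply Rmult_lt_0_compat; lra]).
  exists (CP * exp (p * C1) + C2 ^ 2).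
  assert (0 < CP * exp (p * C1)) by (apply Rmult_lt_0_compat; [easy | apply exp_pos]).
  assert (0 < C2 ^ 2) by now apply pow_lt.
  split; [lra |]. intros eps [He He1].
  destruct (H1 eps He) as [_ HU].
  destruct (prim_bounds eps (Rad - d) He ltac:(lra)) as [Hb1 Hb2]. fold CP in Hb2.
  pose proof (exp_pos (p * U eps (Rad - d))).
  assert (0 < B / p) by now apply Rdiv_lt_0_compat.
  repeat split.
  - nra.
  - assert (exp (p * U eps (Rad - d)) <= exp (p * C1)).
    { apply exp_mono_le, Rmult_le_compat_l; nra. }
    nra.
  - assert (Hdec := at_eps flux_decay He lam0 (Rad - d) lam0_pos lam0_sqr ltac:(lra)).
    replace (Rad - (Rad - d)) with d in Hdec by ring.
    rewrite (flux_end _ _ _ _ _ He (Hsol _ He)) in Hdec.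
    assert (Hph := at_eps flux_nonneg He (Rad - d) ltac:(lra)).
    set (x := lam0 / eps * d) in *.
    assert (Hx : 0 < x) by (apply Rmult_lt_0_compat; [now apply Rdiv_lt_0_compat | lra]).
    replace (- (lam0 / eps) * d) with (- x) in Hdec by (unfold x; ring).
    assert (exp (- x) <= / x).
    { rewrite exp_Ropp. apply Rinv_le_contravar; [easy |]. pose proof (exp_ineq1_le x). lra. }
    assert (HeC : eps * phi eps (Rad - d) <= C2).
    { apply Rle_trans with (eps * (P / eps ^ 2 * / x)).
      - apply Rmult_le_compat_l; [lra |]. apply Rle_trans with (1 := Hdec).
        apply Rmult_le_compat_l; [| easy]. left; apply Rdiv_lt_0_compat; [easy | now apply pow_lt].
      - right. unfold x, C2. field. lra. }
    replace (eps ^ 2 * phi eps (Rad - d) ^ 2) with ((eps * phi eps (Rad - d)) ^ 2) by ring.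
    assert ((eps * phi eps (Rad - d)) ^ 2 <= C2 ^ 2); [| lra].
    apply pow_incr. split; [| easy]. apply Rmult_le_pos; lra.
Qed.

(** The energy comparison on [[Rad/2, Rad]] bounds [Phi(u(Rad))] by [eps^2 phi(Rad)^2] up to
    constants, and the boundary condition makes this of order [eps^(-2)]. Hence [u(Rad)] is at most
    [(2/p) log(1/eps) + O(1)]. *)
Lemma end_exp_bound : exists C, 1 <= C /\
  forall eps, 0 < eps <= 1 -> exp (p * U eps Rad) <= C / eps ^ 2.
Proof.
  destruct (interior_prim_bound (Rad / 2) ltac:(lra)) as [C1 [HC1 H1]].
  replace (Rad - Rad / 2) with (Rad / 2) in H1 by lra.
  set (H := ((Rad / 2) ^ (N - 1)) ^ 2 * gm).
  assert (HH : 0 < H) by (apply Rmult_lt_0_compat; [apply pow_lt, pow_lt; lra | easy]).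
  pose proof INR_dim_pos as HN0. pose proof end_flux_const_pos as HP.
  assert (HP2 : 0 < P ^ 2) by now apply pow_lt.
  assert (HPH : 0 < P ^ 2 / (2 * H)) by (apply Rdiv_lt_0_compat; lra).
  set (C2 := p / B * (C1 + P ^ 2 / (2 * H))).
  assert (HpB : 0 < p / B) by now apply Rdiv_lt_0_compat.
  assert (HC2 : 0 < C2) by (apply Rmult_lt_0_compat; lra).
  exists (C2 + 1). split; [lra |]. intros eps [He He1].
  destruct (H1 eps (conj He He1)) as [[Hi1 Hi2] _].
  assert (E := at_eps energy_ge He H (Rad / 2) Rad ltac:(lra) ltac:(lra) ltac:(lra)).
  assert (E' : H * (Phi eps (U eps Rad) - Phi eps (U eps (Rad / 2)))
     <= eps ^ 2 * phi eps Rad ^ 2 / 2 - eps ^ 2 * phi eps (Rad / 2) ^ 2 / 2).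
  { apply E. intros s Hs. unfold H. destruct (Hbd s); [lra |].
    apply Rmult_le_compat; [left; apply pow_lt, pow_lt; lra | lra | | lra].
    apply pow_incr. split; [left; apply pow_lt; lra | apply pow_incr; lra]. }
  rewrite (flux_end _ _ _ _ _ He (Hsol _ He)) in E'.
  assert (He2 : 0 < eps ^ 2) by now apply pow_lt.
  assert (He2' : eps ^ 2 <= 1) by (simpl; nra).
  destruct (prim_bounds eps Rad He ltac:(lra)) as [Hb _].
  assert (0 <= eps ^ 2 * phi eps (Rad / 2) ^ 2) by (apply Rmult_le_pos; [lra | apply pow2_ge_0]).
  replace (eps ^ 2 * (P / eps ^ 2) ^ 2 / 2) with (P ^ 2 / 2 / eps ^ 2) in E' by (field; lra).
  assert (E2 : Phi eps (U eps Rad) <= C1 + P ^ 2 / (2 * H) / eps ^ 2).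
  { apply Rmult_le_reg_l with H; [easy |].
    replace (H * (C1 + P ^ 2 / (2 * H) / eps ^ 2)) with (H * C1 + P ^ 2 / 2 / eps ^ 2) by (field; lra).
    assert (H * Phi eps (U eps (Rad / 2)) <= H * C1) by (apply Rmult_le_compat_l; lra).
    lra. }
  apply Rmult_le_reg_r with (eps ^ 2); [easy |].
  replace ((C2 + 1) / eps ^ 2 * eps ^ 2) with (C2 + 1) by (field; lra).
  assert (E3 : exp (p * U eps Rad) <= p / B * (C1 + P ^ 2 / (2 * H) / eps ^ 2)).
  { apply Rmult_le_reg_l with (B / p); [now apply Rdiv_lt_0_compat |].
    replace (B / p * (p / B * (C1 + P ^ 2 / (2 * H) / eps ^ 2)))
      with (C1 + P ^ 2 / (2 * H) / eps ^ 2) by (field; lra). lra. }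
  apply Rle_trans with (p / B * (C1 + P ^ 2 / (2 * H) / eps ^ 2) * eps ^ 2).
  - apply Rmult_le_compat_r; lra.
  - replace (p / B * (C1 + P ^ 2 / (2 * H) / eps ^ 2) * eps ^ 2)
      with (p / B * (C1 * eps ^ 2 + P ^ 2 / (2 * H))) by (field; lra).
    assert (p / B * (C1 * eps ^ 2 + P ^ 2 / (2 * H)) <= C2); [| lra].
    apply Rmult_le_compat_l; nra.
Qed.

Lemma layer_edge_gap (kappa : R) : 0 < kappa < 1 ->
  exists e0, 0 < e0 /\ forall eps, 0 < eps < e0 ->
    0 < Rpower eps kappa <= Rad / 2 /\
    U eps (Rad - Rpower eps kappa) - U eps 0 <= eps.
Proof.
  intros Hk. pose proof INR_dim_pos as HN0. pose proof end_flux_const_pos as HP.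
  pose proof lam0_pos as Hl.
  destruct (Rpower_small kappa (Rad / 2)) as [e1 [He1 H1]]; [lra | lra |].
  (* In the exponent [kappa + 1], the power [eps^kappa] cancels the distance [d] on the left of
     [react_decay], and the remaining [eps] absorbs the constants through the threshold [e3]. *)
  destruct (exp_decay_beats_power (lam0 / 2) (1 - kappa) (kappa + 1)) as [e2 [He2 H2]]; [lra | lra |].
  set (c := (Rad / 2) ^ (N - 1) / 2).
  assert (Hc : 0 < c) by (apply Rdiv_lt_0_compat; [apply pow_lt |]; lra).
  assert (HpB : 0 < p * B) by now apply Rmult_lt_0_compat.
  set (e3 := c * (p * B) / P).
  assert (He3 : 0 < e3).
  { apply Rdiv_lt_0_compat; [| easy]. now apply Rmult_lt_0_compat. }
  exists (Rmin e1 (Rmin e2 e3)). split; [now repeat apply Rmin_glb_lt |].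
  intros eps [He Hlt].
  assert (Hlt1 := Rlt_le_trans _ _ _ Hlt (Rmin_l _ _)).
  assert (Hlt2 := Rlt_le_trans _ _ _ Hlt (Rmin_r _ _)).
  assert (Hlt3 := Rlt_le_trans _ _ _ Hlt2 (Rmin_r _ _)).
  apply (fun h => Rlt_le_trans _ _ _ h (Rmin_l _ _)) in Hlt2.
  specialize (H1 eps (conj He Hlt1)). specialize (H2 eps (conj He Hlt2)).
  set (d := Rpower eps kappa) in *. assert (Hd : 0 < d) by apply Rpower_pos.
  split; [lra |].
  assert (H := at_eps react_decay He lam0 (Rad - d) lam0_pos lam0_sqr ltac:(lra)).
  replace (Rad - (Rad - d)) with d in H by ring.
  assert (Hs := at_eps react_slope He (U eps (Rad - d)) ltac:(apply family_nondecreasing; lra)).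
  assert (Hn := at_eps react_nonneg He (Rad - d) ltac:(lra)).
  assert (Hx : lam0 / eps * (d / 2) = lam0 / 2 * Rpower eps (- (1 - kappa))).
  { unfold d. replace (- (1 - kappa)) with (kappa + - (1)) by ring.
    rewrite Rpower_plus, (Rpower_Ropp eps 1), Rpower_1 by easy. field. lra. }
  replace (- (lam0 / eps) * (d / 2)) with (- (lam0 / eps * (d / 2))) in H by ring.
  rewrite Hx in H.
  set (E := exp (- (lam0 / 2 * Rpower eps (- (1 - kappa))))) in *.
  rewrite Rpower_Ropp, Rpower_plus, Rpower_1 in H2 by easy. fold d in H2.
  assert (HE : E <= eps * (d * eps)).
  { apply Rmult_le_reg_l with (/ (d * eps)).
    - apply Rinv_0_lt_compat, Rmult_lt_0_compat; lra.
    - replace (/ (d * eps) * (eps * (d * eps))) with eps by (field; lra). easy. }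
  assert (HF : F eps (U eps (Rad - d)) * (c * d) <= P * (eps * (d * eps))).
  { apply Rle_trans with (P * E); [| apply Rmult_le_compat_l; lra].
    apply Rle_trans with (2 := H). apply Rmult_le_compat_l; [easy |].
    replace (c * d) with ((Rad / 2) ^ (N - 1) * (d / 2)) by (unfold c; field).
    apply Rmult_le_compat_r; [lra |]. apply pow_incr; lra. }
  assert (HF' : F eps (U eps (Rad - d)) * c <= P * eps * eps).
  { apply Rmult_le_reg_r with d; [easy |]. lra. }
  assert (HPe : P * eps <= c * (p * B)).
  { apply Rmult_le_reg_r with (/ P); [now apply Rinv_0_lt_compat |].
    rewrite Rinv_r_simpl_m by lra. left; exact Hlt3. }
  assert (HPee : P * eps * eps <= c * (p * B) * eps) by (apply Rmult_le_compat_r; lra).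
  assert (Hfin : F eps (U eps (Rad - d)) <= p * B * eps).
  { apply Rmult_le_reg_r with c; [easy |]. lra. }
  apply Rmult_le_reg_l with (p * B); [easy |]. lra.
Qed.

(** Up to an error [eps], [u] is constant on this interval. Its central value is nonpositive, which
    gives the upper bound. For the lower bound, the zero mean balances the interior against a layer
    of width [eps^kappa] and height [O(log(1/eps))]. *)
Lemma interior_estimate (kappa : R) : 0 < kappa < 1 ->
  exists C e0, 0 < C /\ 0 < e0 /\ forall eps, 0 < eps < e0 ->
    forall r, 0 <= r <= Rad - Rpower eps kappa ->
      Rabs (U eps r) <= C * Rpower eps kappa * ln (1 / eps).
Proof.
  intros Hk. pose proof INR_dim_pos as HN0.
  destruct (layer_edge_gap kappa Hk) as [e1 [He1 H1]].
  destruct end_exp_bound as [C0 [HC0 HU]].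
  set (C1 := (ln C0 + 2) / p).
  assert (HlnC : 0 <= ln C0) by (rewrite <- ln_1; apply ln_le; lra).
  assert (HC1 : 0 < C1) by (apply Rdiv_lt_0_compat; lra).
  set (C2 := Rad ^ (N - 1) * INR N / (Rad / 2) ^ N).
  assert (HC2 : 0 < C2).
  { apply Rdiv_lt_0_compat; [apply Rmult_lt_0_compat; [now apply pow_lt | easy] | apply pow_lt; lra]. }
  assert (HC12 : 0 < C1 * C2) by now apply Rmult_lt_0_compat.
  (* [C1] comes from the height of the layer, [C2] from the ratio of the volume factors, and the
     summand 1 pays for the error [eps]. The threshold [e^(-1)] ensures [ln (1 / eps) >= 1], so that
     additive constants can be absorbed into the logarithm. *)
  exists (C1 * C2 + 1), (Rmin e1 (exp (- (1)))).
  split; [lra |]. split; [apply Rmin_glb_lt; [easy | apply exp_pos] |].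
  intros eps [He Hlt] r Hr.
  assert (Hlt1 := Rlt_le_trans _ _ _ Hlt (Rmin_l _ _)).
  assert (Hlt2 := Rlt_le_trans _ _ _ Hlt (Rmin_r _ _)).
  destruct (H1 eps (conj He Hlt1)) as [Hd Hgap].
  assert (Hln : 1 <= ln (1 / eps)).
  { replace (1 / eps) with (/ eps) by (field; lra). rewrite ln_Rinv by easy.
    apply ln_increasing in Hlt2; [| easy]. rewrite ln_exp in Hlt2. lra. }
  assert (He1' : eps < 1).
  { assert (Hx := exp_increasing (- (1)) 0 ltac:(lra)). rewrite exp_0 in Hx. lra. }
  assert (Hed : eps <= Rpower eps kappa).
  { unfold Rpower. rewrite <- (exp_ln eps) at 1 by easy. apply exp_mono_le.
    assert (ln eps < 0) by (rewrite <- ln_1; apply ln_increasing; lra). nra. }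
  set (d := Rpower eps kappa) in *. set (l := ln (1 / eps)) in *.
  assert (Hdl : d <= d * l) by nra.
  destruct (family_zero_bounds eps He) as [_ H0].
  assert (Hup : U eps r <= eps).
  { assert (U eps r <= U eps (Rad - d)) by (apply family_nondecreasing; lra). lra. }
  assert (HR1 : U eps Rad <= C1 * l).
  { assert (Hx : p * U eps Rad <= ln C0 + 2 * l).
    { rewrite <- (ln_exp (p * U eps Rad)).
      replace (ln C0 + 2 * l) with (ln (C0 / eps ^ 2)).
      - apply ln_le; [apply exp_pos | apply HU; lra].
      - assert (He2 : 0 < eps ^ 2) by now apply pow_lt.
        unfold l, Rdiv. rewrite Rmult_1_l, ln_Rinv by easy.
        rewrite ln_mult, ln_Rinv by (try apply Rinv_0_lt_compat; lra).
        simpl. rewrite Rmult_1_r, ln_mult by easy. ring. }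
    apply Rmult_le_reg_l with p; [easy |].
    replace (p * (C1 * l)) with ((ln C0 + 2) * l) by (unfold C1; field; lra).
    nra. }
  assert (HR0 := at_eps profile_end_nonneg He).
  assert (Hlow : - U eps (Rad - d) <= C1 * C2 * (d * l)).
  { destruct (Rle_lt_dec 0 (U eps (Rad - d))) as [Hs | Hs].
    - assert (0 <= C1 * C2 * (d * l)); [apply Rmult_le_pos; [lra |] | lra]. apply Rmult_le_pos; lra.
    - assert (Hm := at_eps profile_lower_mean He (Rad - d) ltac:(lra)).
      replace (Rad - (Rad - d)) with d in Hm by ring.
      apply Rmult_le_reg_r with ((Rad / 2) ^ N / INR N).
      { apply Rdiv_lt_0_compat; [apply pow_lt; lra | easy]. }
      apply Rle_trans with (- U eps (Rad - d) * ((Rad - d) ^ N / INR N)).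
      + apply Rmult_le_compat_l; [lra |]. apply Rmult_le_compat_r.
        * left; now apply Rinv_0_lt_compat.
        * apply pow_incr; lra.
      + apply Rle_trans with (1 := Hm).
        replace (C1 * C2 * (d * l) * ((Rad / 2) ^ N / INR N)) with (C1 * l * (Rad ^ (N - 1) * d)).
        * apply Rmult_le_compat_r; [| easy].
          apply Rmult_le_pos; [apply pow_le |]; lra.
        * unfold C2. assert (0 < (Rad / 2) ^ N) by (apply pow_lt; lra). field. lra. }
  assert (HU0 : U eps 0 <= U eps r) by (apply family_nondecreasing; lra).
  apply Rabs_le. replace ((C1 * C2 + 1) * d * l) with (C1 * C2 * (d * l) + d * l) by ring.
  assert (0 <= C1 * C2 * (d * l)) by (apply Rmult_le_pos; [lra | apply Rmult_le_pos; lra]).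
  lra.
Qed.

Lemma interior_slope_estimate (kappa : R) : 0 < kappa < 1 ->
  exists M e0, 0 < M /\ 0 < e0 /\ forall eps, 0 < eps < e0 ->
    forall r, 0 <= r <= Rad - Rpower eps kappa ->
      r ^ (N - 1) * Rabs (W eps r) <= exp (- (M / Rpower eps (1 - kappa))).
Proof.
  intros Hk. pose proof INR_dim_pos as HN0. pose proof end_flux_const_pos as HP.
  pose proof lam0_pos as Hl.
  destruct (exp_decay_beats_power (lam0 / 2) (1 - kappa) 2) as [e1 [He1 H1]]; [lra | lra |].
  (* The decay factor is at most [E^2], where [E] has half the rate. One [E] absorbs
     [P / (gm eps^2)], the other is the stated bound. *)
  exists (lam0 / 2), (Rmin e1 (gm / P)). split; [lra |].
  split; [apply Rmin_glb_lt; [easy | now apply Rdiv_lt_0_compat] |].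
  intros eps [He Hlt] r [Hr0 Hr].
  assert (Hlt1 := Rlt_le_trans _ _ _ Hlt (Rmin_l _ _)).
  assert (Hlt2 := Rlt_le_trans _ _ _ Hlt (Rmin_r _ _)).
  pose proof (Rpower_pos eps kappa) as Hd.
  specialize (H1 eps (conj He Hlt1)).
  destruct Hr0 as [Hr0 | <-].
  2: { rewrite zero_pow_dim by lia. rewrite Rmult_0_l. left; apply exp_pos. }
  assert (Hw := at_eps deriv_nonneg He r ltac:(lra)). rewrite Rabs_right by lra.
  rewrite (deriv_of_flux (W eps) r) by lra.
  destruct (Hbd r) as [Hg1 _]; [lra |].
  assert (Hr1 : 0 < r ^ (N - 1)) by now apply pow_lt.
  replace (r ^ (N - 1) * (phi eps r / (r ^ (N - 1) * g r))) with (phi eps r / g r) by (field; lra).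
  assert (Hdec := at_eps flux_decay He lam0 r lam0_pos lam0_sqr ltac:(lra)).
  rewrite (flux_end _ _ _ _ _ He (Hsol _ He)) in Hdec.
  assert (Hph := at_eps flux_nonneg He r ltac:(lra)).
  replace (lam0 / 2 / Rpower eps (1 - kappa)) with (lam0 / 2 * Rpower eps (- (1 - kappa)))
    by (rewrite Rpower_Ropp; reflexivity).
  set (E := exp (- (lam0 / 2 * Rpower eps (- (1 - kappa))))) in *.
  assert (HE : 0 < E) by apply exp_pos.
  rewrite Rpower_Ropp in H1. replace 2 with (INR 2) in H1 by reflexivity.
  rewrite Rpower_pow in H1 by easy. change (INR 2) with 2 in H1.
  assert (He2 : 0 < eps ^ 2) by now apply pow_lt.
  assert (HEE : exp (- (lam0 / eps) * (Rad - r)) <= E * E).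
  { unfold E. rewrite <- exp_plus. apply exp_mono_le.
    assert (Hx : lam0 / eps * Rpower eps kappa = lam0 * Rpower eps (- (1 - kappa))).
    { replace (- (1 - kappa)) with (kappa + - (1)) by ring.
      rewrite Rpower_plus, (Rpower_Ropp eps 1), Rpower_1 by easy. field. lra. }
    assert (0 < lam0 / eps) by now apply Rdiv_lt_0_compat.
    assert (lam0 / eps * Rpower eps kappa <= lam0 / eps * (Rad - r)) by (apply Rmult_le_compat_l; lra).
    lra. }
  assert (HPe : P * eps <= gm).
  { apply Rmult_le_reg_r with (/ P); [now apply Rinv_0_lt_compat |].
    rewrite Rinv_r_simpl_m by lra. left; exact Hlt2. }
  apply Rmult_le_reg_r with (g r); [lra |].
  replace (phi eps r / g r * g r) with (phi eps r) by (field; lra).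
  apply Rle_trans with (1 := Hdec).
  apply Rle_trans with (P * (/ eps ^ 2 * E) * E).
  - replace (P * (/ eps ^ 2 * E) * E) with (P / eps ^ 2 * (E * E)) by (field; lra).
    apply Rmult_le_compat_l; [left; now apply Rdiv_lt_0_compat | easy].
  - rewrite (Rmult_comm E). apply Rmult_le_compat_r; [lra |].
    apply Rle_trans with (P * eps); [apply Rmult_le_compat_l; lra | lra].
Qed.

Lemma lim_zero : lim0 (fun eps => U eps 0) 0.
Proof.
  destruct (interior_estimate (1 / 2)) as [C [e1 [HC [He1 H1]]]]; [lra |].
  destruct (Rpower_small (1 / 2) Rad) as [e2 [He2 H2]]; [lra | easy |].
  (* The logarithm is at most [4 eps^(-1/4)], so half of the exponent 1/2 survives. *)
  apply (lim0_squeeze (fun eps => - (C * 4) * Rpower eps (1 / 4)) _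
                      (fun eps => (C * 4) * Rpower eps (1 / 4))).
  - exists (Rmin e1 e2). split; [now apply Rmin_glb_lt |]. intros eps [He Hlt].
    assert (Hlt1 := Rlt_le_trans _ _ _ Hlt (Rmin_l _ _)).
    assert (Hlt2 := Rlt_le_trans _ _ _ Hlt (Rmin_r _ _)).
    specialize (H2 eps (conj He Hlt2)).
    assert (H := H1 eps (conj He Hlt1) 0 ltac:(lra)).
    rewrite Ropp_mult_distr_l_reverse. apply Rabs_le_between.
    replace (C * 4 * Rpower eps (1 / 4)) with (C * Rpower eps (1 / 2) * (4 * Rpower eps (- (1 / 4)))).
    + apply Rle_trans with (1 := H). apply Rmult_le_compat_l.
      * apply Rmult_le_pos; [lra | left; apply Rpower_pos].
      * replace 4 with (/ (1 / 4)) at 1 by field. apply ln_le_Rpower; lra.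
    + replace (Rpower eps (1 / 4)) with (Rpower eps (1 / 2) * Rpower eps (- (1 / 4))); [ring |].
      rewrite <- Rpower_plus. f_equal. field.
  - apply (lim0_val _ (- (C * 4) * 0)); [ring |]. apply lim0_scal, lim0_Rpower; lra.
  - apply (lim0_val _ (C * 4 * 0)); [ring |]. apply lim0_scal, lim0_Rpower; lra.
Qed.

Lemma lim_exp_zero (k : R) : lim0 (fun eps => exp (k * U eps 0)) 1.
Proof.
  apply (lim0_val _ (exp (k * 0))); [rewrite Rmult_0_r; apply exp_0 |].
  apply (lim0_comp (fun x => exp (k * x))); [apply lim_zero |]. auto_derive; easy.
Qed.

(** [B <= a] always. Conversely the reaction at the centre is at most its value at [Rad / 2], which
    is [O(eps)]. With [b <= B] this bounds [a e^(p u(0))] by [B e^(-q u(0)) + O(eps)], and [u(0)]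
    tends to 0. *)
Lemma lim_av : lim0 av B.
Proof.
  destruct (interior_gap (Rad / 2)) as [C [HC H]]; [lra |].
  apply (lim0_squeeze (fun _ => B) _
    (fun eps => exp (- p * U eps 0) * (C * eps + B * exp (- q * U eps 0)))).
  - exists 1. split; [lra |]. intros eps [He _].
    destruct (coeff_bounds eps He) as [[Ha [Ha1 Ha2]] [Hb Hb1]]. split; [easy |].
    destruct (H eps He) as [HF _].
    assert (HF0 : F eps (U eps 0) <= C * eps).
    { apply Rle_trans with (2 := HF). apply react_le; try easy.
      apply family_nondecreasing; lra. }
    unfold react in HF0.
    replace (av eps) with (exp (- p * U eps 0) * (av eps * exp (p * U eps 0))).
    + apply Rmult_le_compat_l; [left; apply exp_pos |].
      pose proof (exp_pos (- q * U eps 0)). nra.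
    + replace (- p * U eps 0) with (- (p * U eps 0)) by ring. rewrite exp_Ropp.
      pose proof (exp_pos (p * U eps 0)). field. lra.
  - apply lim0_const.
  - apply (lim0_val _ (1 * (C * 0 + B * 1))); [ring |].
    apply lim0_mult; [apply lim_exp_zero |].
    apply lim0_plus; [apply lim0_scal, lim0_id | apply lim0_scal, lim_exp_zero].
Qed.

(** * The boundary layer *)

Local Notation h0 := ((Rad ^ (N - 1)) ^ 2 * g Rad).
Local Notation s0 := (sqrt (B / (2 * p * g Rad))).
Local Notation v eps r := (exp (- (p / 2) * U eps r)).

Lemma g_end_pos : 0 < g Rad.
Proof. destruct (Hbd Rad); lra. Qed.

Lemma h0_pos : 0 < h0.
Proof. apply Rmult_lt_0_compat; [now apply pow_lt, pow_lt | apply g_end_pos]. Qed.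

Lemma s0_pos : 0 < s0.
Proof.
  pose proof g_end_pos. apply sqrt_lt_R0, Rdiv_lt_0_compat; [easy |].
  apply Rmult_lt_0_compat; lra.
Qed.

Lemma s0_sqr : s0 ^ 2 = B / (2 * p * g Rad).
Proof.
  pose proof g_end_pos. apply pow2_sqrt. left; apply Rdiv_lt_0_compat; [easy |].
  apply Rmult_lt_0_compat; lra.
Qed.

(** The energy comparison on [[Rad - d, r]], divided by [e^(pu)]. Three errors are made small
    independently: the variation of the weight by [d], the distance from [a] to [B] by [eps], and
    the bounded terms, now multiplied by [e^(-pu)], by [M]. *)
Lemma layer_flux (eta : R) : 0 < eta -> exists M d e0, 0 < d < Rad /\ 0 < e0 /\
  forall eps r, 0 < eps < e0 -> Rad - d <= r <= Rad -> M <= U eps r ->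
  Rabs (eps ^ 2 * phi eps r ^ 2 * exp (- p * U eps r) - 2 * h0 * (B / p)) <= eta.
Proof.
  intros Heta. pose proof h0_pos as Hh0. set (h := h0) in *.
  set (Q := B / p). assert (HQ : 0 < Q) by now apply Rdiv_lt_0_compat.
  (* [eta1] is the error allowed in the weight and [tau] the error in the quotient [t] defined
     below. In the final sum [2 eta1 Q] costs at most [eta/4], [2 h tau] costs [eta/6], [2 eta1 tau]
     at most [eta/12], and the initial energy at most [eta/4]. *)
  set (eta1 := Rmin (h / 2) (eta / (8 * Q))).
  assert (Heta1 : 0 < eta1) by (apply Rmin_glb_lt; apply Rdiv_lt_0_compat; lra).
  assert (Heta1h : eta1 <= h / 2) by apply Rmin_l.
  assert (Heta1Q : eta1 * Q <= eta / 8).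
  { apply Rmult_le_reg_r with (/ Q); [now apply Rinv_0_lt_compat |].
    replace (eta1 * Q * / Q) with eta1 by (field; lra).
    replace (eta / 8 * / Q) with (eta / (8 * Q)) by (field; lra). apply Rmin_r. }
  set (tau := eta / (12 * h)).
  assert (Htau : 0 < tau) by (apply Rdiv_lt_0_compat; lra).
  assert (Htauh : h * tau = eta / 12) by (unfold tau; field; lra).
  destruct (continuous_near (fun s => (s ^ (N - 1)) ^ 2 * g s) Rad eta1) as [d0 [Hd0 Hh]]; [| easy |].
  { apply continuous_Rmult; [| apply Hg].
    apply (continuous_comp (fun s => s ^ (N - 1)) (fun z => z ^ 2)); apply continuous_pow. }
  fold h in Hh.
  set (d := Rmin (d0 / 2) (Rad / 2)).
  assert (Hd : 0 < d < Rad /\ d < d0).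
  { assert (d <= d0 / 2) by apply Rmin_l. assert (d <= Rad / 2) by apply Rmin_r.
    assert (0 < d) by (apply Rmin_glb_lt; lra). lra. }
  destruct (interior_prim_bound d ltac:(lra)) as [C [HC HCb]].
  (* [C'] bounds together the energy left at [Rad - d] and the [e^(-qu)] part of the potential. [M]
     is chosen so that [e^(-pu) <= mu] as soon as [u >= M]. *)
  set (C' := C + B / q * exp (q * K)).
  assert (HC2 : 0 < B / q * exp (q * K)).
  { apply Rmult_lt_0_compat; [now apply Rdiv_lt_0_compat | apply exp_pos]. }
  set (mu := Rmin (eta / 4) (tau / 2) / C').
  assert (Hmu : 0 < mu).
  { apply Rdiv_lt_0_compat; [apply Rmin_glb_lt; lra | unfold C'; lra]. }
  assert (HmuC : C' * mu = Rmin (eta / 4) (tau / 2)) by (unfold mu; field; unfold C'; lra).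
  assert (Hm1 := Rmin_l (eta / 4) (tau / 2)). assert (Hm2 := Rmin_r (eta / 4) (tau / 2)).
  destruct (proj2 (lim0_eps av B) lim_av (p * (tau / 2))) as [e1 [He1 Ha]].
  { apply Rmult_lt_0_compat; lra. }
  exists (- ln mu / p), d, (Rmin e1 1).
  split; [easy |]. split; [apply Rmin_glb_lt; lra |].
  intros eps r [He Hlt] Hr HM.
  assert (Hlt1 := Rlt_le_trans _ _ _ Hlt (Rmin_l _ _)).
  assert (Hlt2 := Rlt_le_trans _ _ _ Hlt (Rmin_r _ _)).
  specialize (Ha eps (conj He Hlt1)). apply Rabs_le_between in Ha.
  destruct (coeff_bounds eps He) as [[Ha0 [Ha1 Ha2]] [Hb Hb1]].
  destruct (HCb eps ltac:(lra)) as [[HPhi0 HPhi1] HX0].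
  set (E := exp (- p * U eps r)). assert (HE : 0 < E) by apply exp_pos.
  assert (HEmu : E <= mu).
  { unfold E. rewrite <- (exp_ln mu) by easy. apply exp_mono_le.
    assert (p * (- ln mu / p) <= p * U eps r) by (apply Rmult_le_compat_l; lra).
    replace (p * (- ln mu / p)) with (- ln mu) in H by (field; lra). lra. }
  assert (HCE : C' * E <= C' * mu) by (apply Rmult_le_compat_l; [unfold C' |]; lra).
  assert (Hup := at_eps energy_le He (h + eta1) (Rad - d) r ltac:(lra) ltac:(lra) ltac:(lra)).
  assert (Hlo := at_eps energy_ge He (h - eta1) (Rad - d) r ltac:(lra) ltac:(lra) ltac:(lra)).
  assert (Hhs : forall s, Rad - d < s < r -> h - eta1 <= (s ^ (N - 1)) ^ 2 * g s <= h + eta1).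
  { intros s Hs. assert (Hs' := Hh s ltac:(apply Rabs_def1; lra)). apply Rabs_def2 in Hs'. lra. }
  specialize (Hup ltac:(intros s Hs; apply Hhs, Hs)).
  specialize (Hlo ltac:(intros s Hs; apply Hhs, Hs)).
  set (X := eps ^ 2 * phi eps r ^ 2) in *.
  set (X0 := eps ^ 2 * phi eps (Rad - d) ^ 2) in *.
  set (Phi0 := Phi eps (U eps (Rad - d))) in *.
  assert (HX0p : 0 <= X0) by (apply Rmult_le_pos; [left; now apply pow_lt | apply pow2_ge_0]).
  set (t := (Phi eps (U eps r) - Phi0) * E).
  set (T := bv eps / q * exp (- q * U eps r) * E).
  assert (HT : 0 <= T <= B / q * exp (q * K) * E).
  { unfold T. assert (exp (- q * U eps r) <= exp (q * K)).
    { apply exp_mono_le. assert (HK := family_ge eps r He ltac:(lra)).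
      assert (q * - K <= q * U eps r) by (apply Rmult_le_compat_l; lra). lra. }
    pose proof (exp_pos (- q * U eps r)).
    assert (0 < bv eps / q) by now apply Rdiv_lt_0_compat.
    assert (bv eps / q <= B / q) by (apply Rmult_le_compat_r; [left; now apply Rinv_0_lt_compat | easy]).
    split; [apply Rmult_le_pos; [apply Rmult_le_pos |]; lra |].
    apply Rmult_le_compat_r; [lra |]. apply Rmult_le_compat; lra. }
  assert (Ht : t = av eps / p + T - Phi0 * E).
  { unfold t, T, react_prim.
    assert (HEE : exp (p * U eps r) * E = 1).
    { unfold E. rewrite <- exp_plus. rewrite <- exp_0. f_equal. ring. }
    transitivity (av eps / p * (exp (p * U eps r) * E)
                  + bv eps / q * exp (- q * U eps r) * E - Phi0 * E); [ring | rewrite HEE; ring]. }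
  assert (HC'E : C' * E = C * E + B / q * exp (q * K) * E) by (unfold C'; ring).
  assert (HCE0 : 0 < C * E) by now apply Rmult_lt_0_compat.
  assert (HPE : 0 <= Phi0 * E <= C * E).
  { split; [apply Rmult_le_pos; lra | apply Rmult_le_compat_r; lra]. }
  assert (HXE : 0 <= X0 * E <= C * E).
  { split; [apply Rmult_le_pos; lra | apply Rmult_le_compat_r; lra]. }
  assert (Hap : Q <= av eps / p <= Q + tau / 2).
  { unfold Q. split; (apply Rmult_le_reg_r with p; [easy |]);
      replace (av eps / p * p) with (av eps) by (field; lra).
    - replace (B / p * p) with B by (field; lra). lra.
    - replace ((B / p + tau / 2) * p) with (B + p * (tau / 2)) by (field; lra). lra. }
  assert (Htb : Q - tau <= t <= Q + tau) by lra.
  assert (HupE : X * E <= 2 * (h + eta1) * t + X0 * E).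
  { unfold t. replace (2 * (h + eta1) * ((Phi eps (U eps r) - Phi0) * E) + X0 * E)
      with ((2 * ((h + eta1) * (Phi eps (U eps r) - Phi0)) + X0) * E) by ring.
    apply Rmult_le_compat_r; lra. }
  assert (HloE : 2 * (h - eta1) * t <= X * E).
  { unfold t. replace (2 * (h - eta1) * ((Phi eps (U eps r) - Phi0) * E))
      with (2 * ((h - eta1) * (Phi eps (U eps r) - Phi0)) * E) by ring.
    apply Rmult_le_compat_r; lra. }
  assert (2 * (h + eta1) * t <= 2 * (h + eta1) * (Q + tau)) by (apply Rmult_le_compat_l; lra).
  assert (2 * (h - eta1) * (Q - tau) <= 2 * (h - eta1) * t) by (apply Rmult_le_compat_l; lra).
  assert (0 <= eta1 * tau <= h / 2 * tau).
  { split; [apply Rmult_le_pos; lra | apply Rmult_le_compat_r; lra]. }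
  apply Rabs_le. lra.
Qed.

(** The square of [eps w v] is the quantity of [layer_flux] times [j], the inverse square of
    [r^(N-1) g]. At the boundary the product is [2B / (p g(Rad)) = (2 s0)^2]. *)
Lemma layer_slope (eta : R) : 0 < eta -> exists M d e0, 0 < d < Rad /\ 0 < e0 /\
  forall eps r, 0 < eps < e0 -> Rad - d <= r <= Rad -> M <= U eps r ->
  Rabs (eps * W eps r * v eps r - 2 * s0) <= eta.
Proof.
  intros Heta. pose proof h0_pos as Hh0. pose proof s0_pos as Hs0. pose proof g_end_pos as HgR.
  assert (HRp : 0 < Rad ^ (N - 1)) by now apply pow_lt.
  set (j := fun r => / (r ^ (N - 1) * g r) ^ 2).
  set (Z0 := 2 * h0 * (B / p)).
  assert (HZ0 : 0 < Z0).
  { unfold Z0. apply Rmult_lt_0_compat; [lra | now apply Rdiv_lt_0_compat]. }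
  assert (Hj0 : 0 < j Rad) by (apply Rinv_0_lt_compat, pow_lt, Rmult_lt_0_compat; easy).
  assert (HZj : Z0 * j Rad = (2 * s0) ^ 2).
  { replace ((2 * s0) ^ 2) with (4 * s0 ^ 2) by ring. rewrite s0_sqr.
    unfold Z0, j. field. lra. }
  set (c := 2 * s0) in *. assert (Hc : 0 < c) by (unfold c; lra).
  assert (Hec : 0 < eta * c) by now apply Rmult_lt_0_compat.
  destruct (layer_flux (eta * c / (4 * j Rad))) as [M [d1 [e1 [Hd1 [He1 H1]]]]].
  { apply Rdiv_lt_0_compat; lra. }
  destruct (continuous_near j Rad (Rmin (j Rad) (eta * c / (2 * Z0)))) as [d2 [Hd2 H2]].
  { apply (continuous_comp (fun r => r ^ (N - 1) * g r) (fun z => / z ^ 2)).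
    - apply continuous_Rmult; [apply continuous_pow | apply Hg].
    - apply (@ex_derive_continuous R_AbsRing R_NormedModule (fun z => / z ^ 2)). auto_derive.
      assert (0 < Rad ^ (N - 1) * g Rad) by now apply Rmult_lt_0_compat.
      apply Rgt_not_eq. rewrite Rmult_1_r. now apply Rmult_lt_0_compat. }
  { apply Rmin_glb_lt; [easy |]. apply Rdiv_lt_0_compat; lra. }
  set (d := Rmin d1 (d2 / 2)).
  assert (Hd : 0 < d <= d1 /\ d < d2).
  { assert (d <= d1) by apply Rmin_l. assert (d <= d2 / 2) by apply Rmin_r.
    assert (0 < d) by (apply Rmin_glb_lt; lra). lra. }
  exists M, d, e1. split; [lra |]. split; [easy |]. intros eps r He Hr HM.
  assert (H := H1 eps r He ltac:(lra) HM). fold Z0 in H.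
  assert (Hj := H2 r ltac:(apply Rabs_def1; lra)).
  set (E := exp (- p * U eps r)) in *. set (X := eps ^ 2 * phi eps r ^ 2) in *.
  set (y := eps * W eps r * v eps r).
  assert (Hg1 : 0 < g r) by (destruct (Hbd r); lra).
  assert (Hr1 : 0 < r ^ (N - 1)) by (apply pow_lt; lra).
  assert (Hy2 : y ^ 2 = X * E * j r).
  { unfold y, X, E, j. rewrite (deriv_of_flux (W eps) r) by lra.
    replace (exp (- p * U eps r)) with (v eps r ^ 2).
    - field. lra.
    - simpl. rewrite Rmult_1_r, <- exp_plus. f_equal. field. }
  assert (Hw : 0 <= W eps r) by (apply (at_eps deriv_nonneg (proj1 He)); lra).
  assert (Hy : 0 <= y).
  { unfold y. apply Rmult_le_pos; [apply Rmult_le_pos; lra | left; apply exp_pos]. }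
  assert (Hj1 : Rabs (j r - j Rad) < j Rad) by (apply Rlt_le_trans with (1 := Hj), Rmin_l).
  assert (Hj2 : Rabs (j r - j Rad) < eta * c / (2 * Z0)) by (apply Rlt_le_trans with (1 := Hj), Rmin_r).
  apply Rabs_def2 in Hj1.
  assert (Hdiff : Rabs (y ^ 2 - c ^ 2) <= eta * c).
  { rewrite Hy2, <- HZj.
    replace (X * E * j r - Z0 * j Rad) with ((X * E - Z0) * j r + Z0 * (j r - j Rad)) by ring.
    apply Rle_trans with (1 := Rabs_triang _ _). rewrite !Rabs_mult.
    rewrite (Rabs_right (j r)), (Rabs_right Z0) by lra.
    assert (Rabs (X * E - Z0) * j r <= eta * c / (4 * j Rad) * (2 * j Rad)).
    { apply Rmult_le_compat; [apply Rabs_pos | lra | easy | lra]. }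
    assert (Z0 * Rabs (j r - j Rad) <= Z0 * (eta * c / (2 * Z0))) by (apply Rmult_le_compat_l; lra).
    replace (eta * c / (4 * j Rad) * (2 * j Rad)) with (eta * c / 2) in H0 by (field; lra).
    replace (Z0 * (eta * c / (2 * Z0))) with (eta * c / 2) in H3 by (field; lra). lra. }
  (* As [y >= 0], [c |y - c| <= |y^2 - c^2|], which replaces continuity of the square root. *)
  apply Rmult_le_reg_r with c; [easy |]. apply Rle_trans with (2 := Hdiff).
  replace (y ^ 2 - c ^ 2) with ((y - c) * (y + c)) by ring. rewrite Rabs_mult.
  apply Rmult_le_compat_l; [apply Rabs_pos |]. rewrite Rabs_right; lra.
Qed.

(** An a priori bound that requires neither small [eps] nor large [u]. The energy comparison starts
    at the centre, where the flux vanishes. *)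
Lemma slope_bound : exists C, 0 < C /\ forall eps r, 0 < eps -> Rad / 2 <= r <= Rad ->
  eps * W eps r * v eps r <= C.
Proof.
  set (H := (Rad ^ (N - 1)) ^ 2 * gM). pose proof gM_pos.
  assert (HH : 0 < H) by (apply Rmult_lt_0_compat; [now apply pow_lt, pow_lt | easy]).
  pose proof prim_const_pos as HCP. set (CP := A / p + B / q * exp ((p + q) * K)) in *.
  set (k := (Rad / 2) ^ (N - 1) * gm).
  assert (Hk : 0 < k) by (apply Rmult_lt_0_compat; [apply pow_lt; lra | easy]).
  assert (HHC : 0 < H * CP) by now apply Rmult_lt_0_compat.
  exists ((1 + 2 * (H * CP)) / k). split; [apply Rdiv_lt_0_compat; lra |].
  intros eps r He Hr.
  assert (E := at_eps energy_le He H 0 r ltac:(lra) ltac:(lra) ltac:(lra)).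
  assert (E' : eps ^ 2 * phi eps r ^ 2 / 2 - eps ^ 2 * phi eps 0 ^ 2 / 2
               <= H * (Phi eps (U eps r) - Phi eps (U eps 0))).
  { apply E. intros s Hs. unfold H. destruct (Hbd s); [lra |].
    apply Rmult_le_compat; [apply pow2_ge_0 | lra | | lra].
    apply pow_incr. split; [apply pow_le; lra | apply pow_incr; lra]. }
  rewrite flux_zero in E'.
  destruct (prim_bounds eps 0 He ltac:(lra)) as [Hb0 _].
  destruct (prim_bounds eps r He ltac:(lra)) as [_ Hb]. fold CP in Hb.
  assert (HBp : 0 < B / p * exp (p * U eps 0)).
  { apply Rmult_lt_0_compat; [now apply Rdiv_lt_0_compat | apply exp_pos]. }
  set (y := eps * phi eps r * v eps r).
  assert (HvE : exp (p * U eps r) * v eps r ^ 2 = 1).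
  { simpl. rewrite Rmult_1_r, <- !exp_plus, <- exp_0. f_equal. field. }
  assert (Hv : 0 < v eps r) by apply exp_pos.
  assert (Hy2 : y ^ 2 <= 2 * (H * CP)).
  { assert (E2 : eps ^ 2 * phi eps r ^ 2 <= 2 * (H * CP) * exp (p * U eps r)).
    { assert (H * (Phi eps (U eps r) - Phi eps (U eps 0)) <= H * (CP * exp (p * U eps r))).
      { apply Rmult_le_compat_l; lra. }
      lra. }
    replace (y ^ 2) with (eps ^ 2 * phi eps r ^ 2 * v eps r ^ 2) by (unfold y; ring).
    replace (2 * (H * CP)) with (2 * (H * CP) * exp (p * U eps r) * v eps r ^ 2)
      by (rewrite Rmult_assoc, HvE; ring).
    apply Rmult_le_compat_r; [left; now apply pow_lt | easy]. }
  assert (Hph : 0 <= phi eps r) by (apply (at_eps flux_nonneg He); lra).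
  assert (Hy : 0 <= y).
  { unfold y. apply Rmult_le_pos; [apply Rmult_le_pos; lra | lra]. }
  assert (Hy1 : y <= 1 + 2 * (H * CP)) by nra.
  destruct (Hbd r) as [Hg1 _]; [lra |].
  assert (Hr1 : 0 < r ^ (N - 1)) by (apply pow_lt; lra).
  rewrite (deriv_of_flux (W eps) r) by lra.
  replace (eps * (phi eps r / (r ^ (N - 1) * g r)) * v eps r) with (y * / (r ^ (N - 1) * g r))
    by (unfold y; field; lra).
  apply Rmult_le_compat; [easy | | easy |].
  - left. apply Rinv_0_lt_compat, Rmult_lt_0_compat; lra.
  - apply Rinv_le_contravar; [easy |].
    apply Rmult_le_compat; [apply pow_le; lra | lra | apply pow_incr; lra | easy].
Qed.

(* [v = exp (- p u / 2)] is nearly affine across the boundary layer. *)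
Lemma layer_mean_value (eps r : R) : 0 < eps -> 0 < r < Rad ->
  exists c, r < c < Rad /\
    eps * (v eps r - v eps Rad) = p / 2 * (eps * W eps c * v eps c) * (Rad - r).
Proof.
  intros He Hr. assert (Hs := Hsol eps He).
  destruct (mean_value (fun s => v eps s) (fun s => - (p / 2) * W eps s * v eps s) r Rad)
    as [c [Hc Ec]].
  - lra.
  - intros s Hx. assert (D := profile_deriv _ _ _ _ _ _ _ _ _ _ _ _ Hs s ltac:(lra)).
    auto_derive.
    + eexists; eassumption.
    + rewrite (Derive_eta _ _ _ D). ring.
  - intros s _. apply continuous_exp_scal, (profile_cont _ _ _ _ _ _ _ _ _ _ _ _ Hs).
  - exists c. split; [easy |]. nra.
Qed.

Local Notation omega := (Rad * (A - B) / (INR N * g Rad)).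

Lemma omega_pos : 0 < omega.
Proof.
  apply Rdiv_lt_0_compat; apply Rmult_lt_0_compat; try lra.
  - apply INR_dim_pos.
  - apply g_end_pos.
Qed.

(** The boundary condition is [eps^2 W(Rad) = omega], so the boundary value of [v] is read off from
    its slope. *)
Lemma v_end (eps : R) : 0 < eps -> v eps Rad / eps = eps * W eps Rad * v eps Rad / omega.
Proof.
  intros He. pose proof omega_pos as Ho.
  assert (H := deriv_end _ _ _ _ _ He (Hsol _ He)). rewrite <- H in Ho |- *.
  assert (He2 : 0 < eps ^ 2) by now apply pow_lt.
  assert (W eps Rad <> 0) by (intros H0; rewrite H0 in Ho; lra).
  field. split; [easy | lra].
Qed.

Section BoundaryPoint.

Variable reb : R -> R.
Hypotheses (Hreb : forall eps, 0 < eps -> 0 < reb eps < Rad)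
  (Hnear : lim0 (fun eps => (Rad - reb eps) / eps) 0).

(** This breaks the circularity. By [slope_bound], [v(Rad)] is [O(eps)] and the increment of [v] is
    [O((Rad - reb) / eps)], which tends to 0. So [u] exceeds [M] at [reb], hence on all of
    [[reb, Rad]], and [layer_slope] applies. *)
Lemma layer_uniform (eta : R) : 0 < eta -> exists e0, 0 < e0 /\
  forall eps c, 0 < eps < e0 -> reb eps <= c <= Rad ->
  Rabs (eps * W eps c * v eps c - 2 * s0) <= eta.
Proof.
  intros Heta. pose proof omega_pos as Ho.
  destruct (layer_slope eta Heta) as [M [d [e1 [Hd [He1 H1]]]]].
  destruct slope_bound as [C [HC HCb]].
  set (mu := exp (- (p / 2) * M)). assert (Hmu : 0 < mu) by apply exp_pos.
  set (d' := Rmin d (Rad / 2)).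
  assert (Hd' : 0 < d' <= d /\ d' <= Rad / 2).
  { assert (d' <= d) by apply Rmin_l. assert (d' <= Rad / 2) by apply Rmin_r.
    assert (0 < d') by (apply Rmin_glb_lt; lra). lra. }
  (* Once [Rad - reb <= (k/2) eps], the increment of [v] is at most [p C k / 4 <= mu / 4]. The
     threshold [e3] makes [v(Rad) < mu / 2], so that [v(reb) < mu]. *)
  set (k := Rmin d' (mu / (p * C))).
  assert (HpC : 0 < p * C) by now apply Rmult_lt_0_compat.
  assert (Hk : 0 < k) by (apply Rmin_glb_lt; [lra | now apply Rdiv_lt_0_compat]).
  assert (HkC : p * C * k <= mu).
  { apply Rmult_le_reg_r with (/ (p * C)); [now apply Rinv_0_lt_compat |].
    replace (p * C * k * / (p * C)) with k by (field; lra). apply Rmin_r. }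
  assert (Hkd : k <= d') by apply Rmin_l.
  destruct (proj2 (lim0_eps _ _) Hnear (k / 2)) as [e2 [He2 H2]]; [lra |].
  set (e3 := mu * omega / (2 * C)).
  assert (He3 : 0 < e3) by (apply Rdiv_lt_0_compat; [now apply Rmult_lt_0_compat | lra]).
  exists (Rmin (Rmin e1 e2) (Rmin e3 1)). split; [repeat apply Rmin_glb_lt; lra |].
  intros eps c [He Hlt] Hc.
  assert (Hlt12 := Rlt_le_trans _ _ _ Hlt (Rmin_l _ _)).
  assert (Hlt34 := Rlt_le_trans _ _ _ Hlt (Rmin_r _ _)).
  assert (Hlt1 := Rlt_le_trans _ _ _ Hlt12 (Rmin_l _ _)).
  assert (Hlt2 := Rlt_le_trans _ _ _ Hlt12 (Rmin_r _ _)).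
  assert (Hlt3 := Rlt_le_trans _ _ _ Hlt34 (Rmin_l _ _)).
  assert (Hlt4 := Rlt_le_trans _ _ _ Hlt34 (Rmin_r _ _)).
  destruct (Hreb eps He) as [Hr0 Hr1].
  specialize (H2 eps (conj He Hlt2)). rewrite Rminus_0_r in H2. apply Rabs_le_between in H2.
  assert (Hdist : Rad - reb eps <= k / 2 * eps).
  { apply Rmult_le_reg_r with (/ eps); [now apply Rinv_0_lt_compat |].
    replace (k / 2 * eps * / eps) with (k / 2) by (field; lra). apply H2. }
  assert (Hdk : Rad - reb eps < k) by nra.
  assert (Hvend : v eps Rad < mu / 2).
  { replace (v eps Rad) with (v eps Rad / eps * eps) by (field; lra).
    rewrite (v_end eps He).
    assert (Hb := HCb eps Rad He ltac:(lra)).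
    apply Rle_lt_trans with (C / omega * eps).
    - apply Rmult_le_compat_r; [lra |]. apply Rmult_le_compat_r; [| easy].
      left; now apply Rinv_0_lt_compat.
    - replace (mu / 2) with (C / omega * e3).
      + apply Rmult_lt_compat_l; [now apply Rdiv_lt_0_compat | easy].
      + unfold e3. set (o := omega) in *. field. lra. }
  assert (Hvr : v eps (reb eps) < mu).
  { destruct (layer_mean_value eps (reb eps) He (Hreb eps He)) as [x [Hx Ex]].
    assert (Hb := HCb eps x He ltac:(lra)).
    assert (Hle : eps * (v eps (reb eps) - v eps Rad) <= p / 2 * C * (k / 2 * eps)).
    { rewrite Ex. apply Rmult_le_compat; [| lra | | easy].
      - apply Rmult_le_pos; [lra |].
        assert (Hw : 0 <= W eps x) by (apply (at_eps deriv_nonneg He); lra).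
        apply Rmult_le_pos; [apply Rmult_le_pos; lra | left; apply exp_pos].
      - apply Rmult_le_compat_l; lra. }
    assert (v eps (reb eps) - v eps Rad <= p * C * k / 4).
    { apply Rmult_le_reg_l with eps; [easy |]. lra. }
    lra. }
  apply H1; [lra | lra |].
  assert (HUr : M < U eps (reb eps)).
  { apply Rnot_le_lt. intros Hle. apply (Rlt_not_le _ _ Hvr). apply exp_mono_le.
    assert (p / 2 * U eps (reb eps) <= p / 2 * M) by (apply Rmult_le_compat_l; lra). lra. }
  assert (U eps (reb eps) <= U eps c) by (apply family_nondecreasing; lra). lra.
Qed.

Lemma lim_slope : lim0 (fun eps => eps * W eps (reb eps) * v eps (reb eps)) (2 * s0).
Proof.
  apply lim0_eps. intros eta Heta. destruct (layer_uniform eta Heta) as [e0 [He0 H]].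
  exists e0. split; [easy |]. intros eps He. apply H; [easy |].
  pose proof (Hreb eps (proj1 He)). lra.
Qed.

Lemma lim_v_end : lim0 (fun eps => v eps Rad / eps) (2 * s0 / omega).
Proof.
  pose proof omega_pos.
  apply (lim0_ext (fun eps => eps * W eps Rad * v eps Rad / omega)).
  { intros eps He. symmetry. now apply v_end. }
  apply lim0_div; [lra | | apply lim0_const].
  apply lim0_eps. intros eta Heta. destruct (layer_uniform eta Heta) as [e0 [He0 H0]].
  exists e0. split; [easy |]. intros eps He. apply H0; [easy |].
  pose proof (Hreb eps (proj1 He)). lra.
Qed.

Lemma lim_v_increment :
  lim0 (fun eps => eps * (v eps (reb eps) - v eps Rad) / (Rad - reb eps)) (p * s0).
Proof.
  apply lim0_eps. intros eta Heta.
  destruct (layer_uniform (2 / p * eta)) as [e0 [He0 H]].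
  { apply Rmult_lt_0_compat; [apply Rdiv_lt_0_compat |]; lra. }
  exists e0. split; [easy |]. intros eps He.
  assert (Hr := Hreb eps (proj1 He)).
  destruct (layer_mean_value eps (reb eps) (proj1 He) Hr) as [c [Hc Ec]].
  assert (Hu := H eps c He ltac:(lra)). rewrite Ec.
  replace (p / 2 * (eps * W eps c * v eps c) * (Rad - reb eps) / (Rad - reb eps) - p * s0)
    with (p / 2 * (eps * W eps c * v eps c - 2 * s0)) by (field; lra).
  rewrite Rabs_mult, (Rabs_right (p / 2)) by lra.
  replace eta with (p / 2 * (2 / p * eta)) by (field; lra).
  apply Rmult_le_compat_l; lra.
Qed.

End BoundaryPoint.

(** * Expansions at distance of order [eps^beta] from the boundary *)

Section Expansion.

Variables (beta gamma : R) (reb : R -> R).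
Hypotheses (Hbeta : 1 < beta) (Hgamma : 0 < gamma)
  (Hreb : forall eps, 0 < eps -> 0 < reb eps < Rad)
  (Hlim : lim0 (fun eps => (Rad - reb eps) / Rpower eps beta) gamma).

Local Notation m := (Rmin 1 (beta - 1)).
Local Notation S := (gamma * p * chi1 beta + 2 * INR N * g Rad / (Rad * (A - B)) * chi2 beta).

Lemma boundary_distance : lim0 (fun eps => (Rad - reb eps) / eps) 0.
Proof.
  apply (lim0_ext (fun eps => (Rad - reb eps) / Rpower eps beta * Rpower eps (beta - 1))).
  - intros eps He. replace (beta - 1) with (beta + - (1)) by ring.
    rewrite Rpower_plus, Rpower_Ropp, Rpower_1 by easy.
    pose proof (Rpower_pos eps beta). field. lra.
  - apply (lim0_val _ (gamma * 0)); [ring |].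
    apply lim0_mult; [exact Hlim | apply lim0_Rpower; lra].
Qed.

Lemma scale_sum_pos : 0 < S.
Proof.
  assert (H1 : 0 < gamma * p) by now apply Rmult_lt_0_compat.
  assert (H2 : 0 < 2 * INR N * g Rad / (Rad * (A - B))).
  { pose proof g_end_pos. pose proof INR_dim_pos.
    apply Rdiv_lt_0_compat; repeat apply Rmult_lt_0_compat; lra. }
  unfold chi1, chi2. destruct (Rle_dec beta 2), (Rlt_dec beta 2); lra.
Qed.

Lemma lim0_Rpower_zero : lim0 (fun eps => Rpower eps 0) 1.
Proof.
  apply (lim0_ext (fun _ => 1)); [| apply lim0_const].
  intros e He. now rewrite Rpower_O.
Qed.

Lemma lim_chi1 : lim0 (fun eps => Rpower eps (beta - 1 - m)) (chi1 beta).
Proof.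
  unfold chi1. destruct (Rle_dec beta 2).
  - rewrite Rmin_right by lra. replace (beta - 1 - (beta - 1)) with 0 by ring.
    apply lim0_Rpower_zero.
  - rewrite Rmin_left by lra. apply lim0_Rpower; lra.
Qed.

Lemma lim_chi2 : lim0 (fun eps => Rpower eps (1 - m)) (chi2 beta).
Proof.
  unfold chi2. destruct (Rlt_dec beta 2).
  - rewrite Rmin_right by lra. apply lim0_Rpower; lra.
  - rewrite Rmin_left by lra. replace (1 - 1) with 0 by ring. apply lim0_Rpower_zero.
Qed.

(** [v(reb)] is the boundary value, of order [eps], plus the increment, of order [eps^(beta-1)].
    After division by the larger of the two scales, [chi2] and [chi1] are the limits of the rescaled
    powers and tell which contributions survive. *)
Lemma lim_v_scaled : lim0 (fun eps => v eps (reb eps) / Rpower eps m) (s0 * S).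
Proof.
  pose proof omega_pos as Ho. pose proof boundary_distance as Hnear.
  apply (lim0_ext (fun eps => v eps Rad / eps * Rpower eps (1 - m)
    + eps * (v eps (reb eps) - v eps Rad) / (Rad - reb eps)
      * ((Rad - reb eps) / Rpower eps beta) * Rpower eps (beta - 1 - m))).
  - intros eps He. assert (Hr := Hreb eps He).
    replace (1 - m) with (1 + - m) by ring.
    replace (beta - 1 - m) with (beta + (- (1) + - m)) by ring.
    rewrite !Rpower_plus, !Rpower_Ropp, Rpower_1 by easy.
    pose proof (Rpower_pos eps beta). pose proof (Rpower_pos eps m). field. lra.
  - apply (lim0_val _ (2 * s0 / omega * chi2 beta + p * s0 * gamma * chi1 beta)).
    + pose proof g_end_pos. pose proof INR_dim_pos. field. lra.
    + apply lim0_plus.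
      * apply lim0_mult; [now apply (lim_v_end reb) | apply lim_chi2].
      * apply lim0_mult; [| apply lim_chi1].
        apply lim0_mult; [now apply lim_v_increment | exact Hlim].
Qed.

Lemma ln_v (eps r : R) : U eps r = - (2 / p) * ln (v eps r).
Proof. rewrite ln_exp. field. lra. Qed.

Lemma limit_value_pos : 0 < s0 * S.
Proof. apply Rmult_lt_0_compat; [apply s0_pos | apply scale_sum_pos]. Qed.

Lemma potential_expansion :
  lim0 (fun eps => U eps (reb eps) -
          (2 / p * m * ln (1 / eps) - 2 / p * ln (s0 * S))) 0.
Proof.
  pose proof limit_value_pos as HL. set (L := s0 * S) in *.
  apply (lim0_ext (fun eps => - (2 / p) * ln (v eps (reb eps) / Rpower eps m) + 2 / p * ln L)).
  - intros eps He. rewrite (ln_v eps (reb eps)) at 2.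
    replace (ln (1 / eps)) with (- ln eps)
      by (unfold Rdiv; rewrite Rmult_1_l, ln_Rinv; easy).
    rewrite ln_div by (apply exp_pos || apply Rpower_pos).
    unfold Rpower. rewrite (ln_exp (m * ln eps)). ring.
  - apply (lim0_val _ (- (2 / p) * ln L + 2 / p * ln L)); [ring |].
    apply lim0_plus; [| apply lim0_const]. apply lim0_scal.
    apply (lim0_comp ln); [apply lim_v_scaled |]. auto_derive. easy.
Qed.

(** The quotient of the limits of [eps w v] and [v / eps^m], in which [s0] cancels. *)
Lemma slope_expansion : lim0 (fun eps => W eps (reb eps) * Rpower eps (1 + m)) (2 / S).
Proof.
  pose proof limit_value_pos as HL. pose proof s0_pos. pose proof scale_sum_pos.
  apply (lim0_ext (fun eps => eps * W eps (reb eps) * v eps (reb eps)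
                              / (v eps (reb eps) / Rpower eps m))).
  - intros eps He. rewrite Rpower_plus, Rpower_1 by easy.
    pose proof (Rpower_pos eps m). pose proof (exp_pos (- (p / 2) * U eps (reb eps))).
    field. lra.
  - apply (lim0_val _ (2 * s0 / (s0 * S))); [set (T := S) in *; field; lra |].
    apply lim0_div; [lra | | apply lim_v_scaled].
    apply lim_slope; [easy | apply boundary_distance].
Qed.

(** The growing exponential is [a / v^2]. The other one stays bounded because [u >= - K], so the
    factor [eps^(2m)] removes it. *)
Lemma reaction_expansion :
  lim0 (fun eps => F eps (U eps (reb eps)) * Rpower eps (2 * m)) (2 * p * g Rad / S ^ 2).
Proof.
  pose proof limit_value_pos as HL. pose proof s0_pos as Hs0. pose proof scale_sum_pos as HS.
  assert (Hm : 0 < m) by (apply Rmin_glb_lt; lra).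
  apply (lim0_ext (fun eps => av eps / (v eps (reb eps) / Rpower eps m) ^ 2
           + - (bv eps * exp (- q * U eps (reb eps)) * Rpower eps (2 * m)))).
  - intros eps He. unfold react.
    replace (Rpower eps (2 * m)) with (Rpower eps m ^ 2).
    2: { replace (2 * m) with (m + m) by ring. rewrite Rpower_plus. ring. }
    pose proof (Rpower_pos eps m). pose proof (exp_pos (- (p / 2) * U eps (reb eps))).
    replace (exp (p * U eps (reb eps))) with (/ v eps (reb eps) ^ 2).
    2: { simpl. rewrite Rmult_1_r, <- exp_plus, <- exp_Ropp. f_equal. field. }
    field. lra.
  - apply (lim0_val _ (B / (s0 * S) ^ 2 + - 0)).
    { replace ((s0 * S) ^ 2) with (s0 ^ 2 * S ^ 2) by ring. rewrite s0_sqr.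
      pose proof g_end_pos. set (T := S) in *. field. lra. }
    apply lim0_plus.
    + apply lim0_div; [| apply lim_av |].
      * apply Rgt_not_eq. now apply pow_lt.
      * apply (lim0_comp (fun z => z ^ 2)); [apply lim_v_scaled |]. auto_derive. easy.
    + apply (lim0_squeeze (fun eps => - (B * exp (q * K)) * Rpower eps (2 * m)) _ (fun _ => - 0)).
      * exists 1. split; [lra |]. intros eps [He _].
        destruct (coeff_bounds eps He) as [_ [Hb Hb1]].
        assert (exp (- q * U eps (reb eps)) <= exp (q * K)).
        { apply exp_mono_le. pose proof (Hreb eps He).
          assert (HK := family_ge eps (reb eps) He ltac:(lra)).
          assert (q * - K <= q * U eps (reb eps)) by (apply Rmult_le_compat_l; lra). lra. }
        pose proof (exp_pos (- q * U eps (reb eps))).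
        pose proof (Rpower_pos eps (2 * m)) as HPw.
        rewrite Ropp_mult_distr_l_reverse. split; apply Ropp_le_contravar.
        -- apply Rmult_le_compat_r; [lra |]. apply Rmult_le_compat; lra.
        -- apply Rmult_le_pos; [apply Rmult_le_pos |]; lra.
      * apply (lim0_val _ (- (B * exp (q * K)) * 0)); [ring |].
        apply lim0_scal, lim0_Rpower. lra.
      * apply lim0_const.
Qed.

(** For [beta > 2] the increment of [v] is negligible against [v(Rad)], so both values of [v] have
    the same leading coefficient and their logarithms differ by [o(1)]. *)
Lemma potential_near_end : 2 < beta -> lim0 (fun eps => U eps (reb eps) - U eps Rad) 0.
Proof.
  intros Hb2. pose proof omega_pos as Ho. pose proof s0_pos as Hs0.
  pose proof boundary_distance as Hnear. pose proof limit_value_pos as HL.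
  assert (Hend : 0 < 2 * s0 / omega) by (apply Rdiv_lt_0_compat; lra).
  assert (HS : s0 * S = 2 * s0 / omega).
  { unfold chi1, chi2. destruct (Rle_dec beta 2), (Rlt_dec beta 2); try lra.
    pose proof g_end_pos. pose proof INR_dim_pos. field. lra. }
  apply (lim0_ext (fun eps => - (2 / p) * ln (v eps (reb eps) / Rpower eps m)
                              + 2 / p * ln (v eps Rad / eps))).
  - intros eps He. rewrite (ln_v eps (reb eps)) at 2. rewrite (ln_v eps Rad) at 2.
    rewrite Rmin_left, Rpower_1 by lra.
    rewrite !ln_div by (apply exp_pos || easy). ring.
  - apply (lim0_val _ (- (2 / p) * ln (s0 * S) + 2 / p * ln (2 * s0 / omega))).
    { rewrite HS. ring. }
    apply lim0_plus; apply lim0_scal.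
    + apply (lim0_comp ln); [apply lim_v_scaled |]. auto_derive. easy.
    + apply (lim0_comp ln); [now apply (lim_v_end reb) |]. auto_derive. easy.
Qed.

End Expansion.

End Radial.

(** * Reduction to the case B < A *)

(* A solution is only controlled on [[0, Rad]]; composing with [clamp] makes it continuous
   everywhere without changing it there. *)
Definition clamp (Rad x : R) : R := Rmax 0 (Rmin x Rad).

Lemma clamp_id (Rad x : R) : 0 <= x <= Rad -> clamp Rad x = x.
Proof. intros H. unfold clamp. rewrite Rmin_left, Rmax_right; lra. Qed.

Lemma clamp_range (Rad x : R) : 0 <= Rad -> 0 <= clamp Rad x <= Rad.
Proof.
  intros H. unfold clamp. split; [apply Rmax_l |].
  apply Rmax_lub; [easy | apply Rmin_r].
Qed.

Lemma clamp_lipschitz (Rad x y : R) : Rabs (clamp Rad y - clamp Rad x) <= Rabs (y - x).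
Proof.
  unfold clamp, Rmax, Rmin.
  destruct (Rle_dec x Rad), (Rle_dec y Rad); repeat destruct Rle_dec;
    unfold Rabs; repeat destruct Rcase_abs; lra.
Qed.

(** Since [clamp] does not increase distances and lands in [[0, Rad]], continuity relative to the
    closed interval, which is what [C1_closed] grants at the endpoints, becomes continuity on the
    whole line. *)
Lemma continuous_clamp (Rad : R) (f : R -> R) (x : R) : 0 <= Rad ->
  filterlim f (within (fun y => 0 <= y <= Rad) (locally (clamp Rad x)))
    (locally (f (clamp Rad x))) ->
  continuous (fun y => f (clamp Rad y)) x.
Proof.
  intros HR Hf. apply (fun H => filterlim_comp _ _ _ (clamp Rad) f (locally x) _ _ H Hf).
  intros P [d Hd]. exists d. intros y Hy. apply Hd; [| now apply clamp_range].
  apply Rle_lt_trans with (2 := Hy). apply clamp_lipschitz.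
Qed.

Lemma deriv_within_continuous (a b : R) (u du : R -> R) (x : R) : a <= x <= b ->
  deriv_within a b u du x ->
  filterlim u (within (fun y => a <= y <= b) (locally x)) (locally (u x)).
Proof.
  intros Hx H. apply filterlim_locally. intros eta.
  destruct (proj1 (filterlim_locally _ _) H (mkposreal 1 Rlt_0_1)) as [d Hd].
  set (L := Rabs (du x) + 1). assert (HL : 0 < L) by (pose proof (Rabs_pos (du x)); unfold L; lra).
  assert (Hd' : 0 < Rmin d (eta / L)).
  { apply Rmin_glb_lt; [apply cond_pos | apply Rdiv_lt_0_compat; [apply cond_pos | easy]]. }
  exists (mkposreal _ Hd').
  cut (forall y : R, Rabs (y - x) < Rmin d (eta / L) -> a <= y <= b -> Rabs (u y - u x) < eta).
  { intros Hcut y. exact (Hcut y). }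
  intros y Hy Hyab.
  destruct (Req_dec y x) as [-> | Hne].
  { rewrite Rminus_diag, Rabs_R0. apply cond_pos. }
  assert (Hq : Rabs ((u (x + (y - x)) - u x) / (y - x) - du x) < 1).
  { apply (Hd (y - x)); [| split; [lra |]; replace (x + (y - x)) with y by ring; easy].
    change (Rabs (y - x - 0) < d). rewrite Rminus_0_r.
    apply Rlt_le_trans with (1 := Hy), Rmin_l. }
  replace (x + (y - x)) with y in Hq by ring.
  assert (Hyx : 0 < Rabs (y - x)) by (apply Rabs_pos_lt; lra).
  replace (u y - u x) with ((u y - u x) / (y - x) * (y - x)) by (field; lra).
  rewrite Rabs_mult.
  assert (Hle : Rabs ((u y - u x) / (y - x)) <= L).
  { replace ((u y - u x) / (y - x)) with (((u y - u x) / (y - x) - du x) + du x) by ring.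
    apply Rle_trans with (1 := Rabs_triang _ _). unfold L. lra. }
  apply Rle_lt_trans with (L * Rabs (y - x)); [apply Rmult_le_compat_r; lra |].
  apply Rmult_lt_reg_r with (/ L); [now apply Rinv_0_lt_compat |].
  replace (L * Rabs (y - x) * / L) with (Rabs (y - x)) by (field; lra).
  apply Rlt_le_trans with (1 := Hy), Rmin_r.
Qed.

Lemma deriv_within_interior (a b : R) (u du : R -> R) (x : R) : a < x < b ->
  deriv_within a b u du x -> is_derive u x (du x).
Proof.
  intros Hx H. apply is_derive_Reals. intros eta Heta.
  destruct (proj1 (filterlim_locally _ _) H (mkposreal eta Heta)) as [d Hd].
  assert (Hd' : 0 < Rmin d (Rmin (x - a) (b - x))).
  { apply Rmin_glb_lt; [apply cond_pos | apply Rmin_glb_lt; lra]. }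
  exists (mkposreal _ Hd'). intros h Hh Hlt. simpl in Hlt.
  assert (H1 := Rlt_le_trans _ _ _ Hlt (Rmin_l _ _)).
  assert (H2 := Rlt_le_trans _ _ _ Hlt (Rmin_r _ _)).
  assert (H3 := Rlt_le_trans _ _ _ H2 (Rmin_l _ _)).
  assert (H4 := Rlt_le_trans _ _ _ H2 (Rmin_r _ _)).
  apply Rabs_def2 in H3. apply Rabs_def2 in H4.
  apply (Hd h); [| split; [easy | lra]].
  change (Rabs (h - 0) < d). now rewrite Rminus_0_r.
Qed.

Lemma locally_open_interval (a b x : R) : a < x < b -> locally x (fun y => a < y < b).
Proof.
  intros H. apply (open_and (fun y => a < y) (fun y => y < b)); [| | easy].
  - apply open_gt.
  - apply open_lt.
Qed.

(** * From the original problem to a [profile], and the symmetry under [u -> -u] *)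

Lemma is_derive_flux (N : nat) (g w : R -> R) (r l : R) :
  (2 <= N)%nat -> 0 < r -> 0 < g r -> ex_derive g r -> is_derive w r l ->
  is_derive (flux N g w) r
    (r ^ (N - 1) * g r * (l + ((INR N - 1) / r + Derive g r / g r) * w r)).
Proof.
  intros HN Hr Hgr Dg Dw. unfold flux. auto_derive.
  - repeat split; [easy | eexists; eassumption].
  - rewrite (Derive_eta _ _ _ Dw), (Derive_eta _ _ _ (Derive_correct g r Dg)).
    replace (r ^ (N - 1)) with (r * r ^ pred (N - 1))
      by (rewrite tech_pow_Rmult; f_equal; lia).
    rewrite minus_INR by lia. simpl INR. field. lra.
Qed.

Definition charge_coeff (N : nat) (Rad c k : R) (u : R -> R) : R :=
  Rad ^ N / INR N * c / RInt (fun s => s ^ (N - 1) * exp (k * u s)) 0 Rad.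

Lemma nstar_rhs_react (N : nat) (Rad A B p q : R) (u : R -> R) (r : R) :
  nstar_rhs N Rad A B p q u r =
  react (charge_coeff N Rad A p u) (charge_coeff N Rad B (- q) u) p q (u r).
Proof. unfold nstar_rhs, react, charge_coeff, Rdiv. ring. Qed.

Lemma nstar_rhs_opp (N : nat) (Rad A B p q : R) (u : R -> R) (r : R) :
  nstar_rhs N Rad B A q p (fun x => - u x) r = - nstar_rhs N Rad A B p q u r.
Proof.
  unfold nstar_rhs.
  rewrite (RInt_ext (fun s => s ^ (N - 1) * exp (q * - u s)) (fun s => s ^ (N - 1) * exp (- q * u s)))
    by (intros; do 2 f_equal; ring).
  rewrite (RInt_ext (fun s => s ^ (N - 1) * exp (- p * - u s)) (fun s => s ^ (N - 1) * exp (p * u s)))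
    by (intros; do 2 f_equal; ring).
  replace (q * - u r) with (- q * u r) by ring. replace (- p * - u r) with (p * u r) by ring.
  unfold Rdiv. ring.
Qed.

Section Solution.

Variables (N : nat) (Rad : R) (g : R -> R) (A B p q eps : R) (u du : R -> R).
Hypotheses (HN : (2 <= N)%nat) (HR : 0 < Rad) (Hg : smooth g)
  (Hgpos : forall x, 0 <= x <= Rad -> 0 < g x) (Heps : 0 < eps)
  (Hsol : solves_Nstar N Rad g A B p q eps u du).

Local Notation uc := (fun x => u (clamp Rad x)).
Local Notation wc := (fun x => du (clamp Rad x)).

Lemma smooth_ex_derive (x : R) : ex_derive g x.
Proof. exact (Hg 1%nat x). Qed.

Lemma clamp_cont_u (x : R) : continuous uc x.
Proof.
  destruct Hsol as [[H1 _] _]. assert (Hc := clamp_range Rad x ltac:(lra)).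
  apply continuous_clamp; [lra |]. now apply (deriv_within_continuous 0 Rad u du), H1.
Qed.

Lemma clamp_cont_du (x : R) : continuous wc x.
Proof.
  destruct Hsol as [[_ H1] _]. assert (Hc := clamp_range Rad x ltac:(lra)).
  apply continuous_clamp; [lra |]. now apply H1.
Qed.

Lemma solution_deriv (r : R) : 0 < r < Rad -> is_derive u r (du r).
Proof.
  intros Hr. destruct Hsol as [[H1 _] _].
  apply (deriv_within_interior 0 Rad); [easy |]. apply H1; lra.
Qed.

Lemma is_derive_clamp (f : R -> R) (r l : R) :
  0 < r < Rad -> is_derive f r l -> is_derive (fun x => f (clamp Rad x)) r l.
Proof.
  intros Hr. apply is_derive_ext_loc.
  apply filter_imp with (2 := locally_open_interval 0 Rad r Hr).
  intros y Hy. rewrite clamp_id; lra.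
Qed.

(** Interior smoothness speaks of [Derive u], which agrees with [du] only on the open interval,
    hence the local extensionality. *)
Lemma solution_second_deriv (r : R) : 0 < r < Rad -> is_derive du r (Derive du r).
Proof.
  intros Hr. apply Derive_correct. destruct Hsol as [_ [H2 _]].
  apply ex_derive_ext_loc with (2 := H2 2%nat r Hr).
  apply filter_imp with (2 := locally_open_interval 0 Rad r Hr).
  intros y Hy. apply is_derive_unique. now apply solution_deriv.
Qed.

Lemma RInt_clamp (f : R -> R -> R) :
  RInt (fun s => f s (u (clamp Rad s))) 0 Rad = RInt (fun s => f s (u s)) 0 Rad.
Proof.
  apply RInt_ext. intros s. rewrite Rmin_left, Rmax_right by lra. intros Hs.
  rewrite clamp_id; lra.
Qed.

Lemma solution_mean : RInt (fun s => s ^ (N - 1) * uc s) 0 Rad = 0.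
Proof.
  cbv beta. rewrite (RInt_clamp (fun s y => s ^ (N - 1) * y)).
  destruct Hsol as [_ [_ [_ [H _]]]]. exact H.
Qed.

Lemma solution_RInt_pos (k : R) : 0 < RInt (fun s => s ^ (N - 1) * exp (k * u s)) 0 Rad.
Proof.
  assert (H := RInt_weighted_exp_ge N Rad HN HR uc clamp_cont_u solution_mean k).
  cbv beta in H. rewrite (RInt_clamp (fun s y => s ^ (N - 1) * exp (k * y))) in H.
  apply Rlt_le_trans with (2 := H). now apply ball_volume_pos.
Qed.

Lemma profile_of_solution :
  profile N Rad g A B p q eps (charge_coeff N Rad A p u) (charge_coeff N Rad B (- q) u) uc wc.
Proof.
  assert (HN0 := INR_dim_pos N HN).
  split.
  - apply clamp_cont_u.
  - apply clamp_cont_du.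
  - intros r Hr. rewrite (clamp_id Rad r) by lra.
    apply is_derive_clamp; [easy | now apply solution_deriv].
  - intros r Hr.
    assert (D1 := is_derive_clamp du r _ Hr (solution_second_deriv r Hr)).
    assert (Hgr : 0 < g r) by (apply Hgpos; lra).
    destruct Hsol as [_ [_ [H _]]]. specialize (H r Hr).
    rewrite nstar_rhs_react in H. rewrite (clamp_id Rad r) by lra. rewrite <- H.
    evar_last.
    + apply (is_derive_flux N g _ r _ HN (proj1 Hr) Hgr (smooth_ex_derive r) D1).
    + cbv beta. rewrite (clamp_id Rad r) by lra. field. lra.
  - apply solution_mean.
  - cbv beta. rewrite (RInt_clamp (fun s y => s ^ (N - 1) * exp (p * y))). unfold charge_coeff.
    pose proof (solution_RInt_pos p). field. lra.
  - cbv beta. rewrite (RInt_clamp (fun s y => s ^ (N - 1) * exp (- q * y))). unfold charge_coeff.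
    pose proof (solution_RInt_pos (- q)). field. lra.
  - unfold flux. rewrite clamp_id by lra.
    destruct Hsol as [_ [_ [_ [_ [_ ->]]]]].
    assert (0 < g Rad) by (apply Hgpos; lra).
    replace (Rad ^ N) with (Rad * Rad ^ (N - 1)) by (rewrite tech_pow_Rmult; f_equal; lia).
    field. lra.
Qed.

Lemma solves_Nstar_opp :
  solves_Nstar N Rad g B A q p eps (fun x => - u x) (fun x => - du x).
Proof.
  assert (Hd2 := solution_second_deriv).
  (* Pulling the sign out of the mean requires integrability, obtained from the clamped, everywhere
     continuous version of [u]. *)
  assert (Hm : ex_RInt (fun s => s ^ (N - 1) * u s) 0 Rad).
  { apply (ex_RInt_ext (fun s => s ^ (N - 1) * uc s)).
    - intros s. rewrite Rmin_left, Rmax_right by lra. intros Hs. rewrite clamp_id; lra.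
    - apply (ex_RInt_weighted N uc), clamp_cont_u. }
  destruct Hsol as [[H1 H2] [H3 [H4 [H5 [H6 H7]]]]].
  split; [split | split; [| split; [| split; [| split]]]].
  - intros x Hx. assert (H := H1 x Hx). unfold deriv_within in *.
    apply (filterlim_ext (fun h => opp ((u (x + h) - u x) / h))).
    { intros h. change (- ((u (x + h) - u x) / h) = (- u (x + h) - - u x) / h).
      unfold Rdiv. ring. }
    apply (filterlim_comp _ _ _ _ opp _ _ _ H).
    apply (filterlim_opp (V := R_NormedModule)).
  - intros x Hx. apply (filterlim_comp _ _ _ _ opp _ _ _ (H2 x Hx)).
    apply (filterlim_opp (V := R_NormedModule)).
  - intros n x Hx. apply ex_derive_n_opp. now apply H3.
  - intros r Hr. rewrite Derive_opp.
    rewrite nstar_rhs_opp, <- (H4 r Hr). ring.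
  - rewrite (RInt_ext _ (fun s => opp (s ^ (N - 1) * u s))).
    2: { intros s _. change (s ^ (N - 1) * - u s = - (s ^ (N - 1) * u s)). ring. }
    rewrite (RInt_opp (V := R_CompleteNormedModule)) by exact Hm. rewrite H5. apply Ropp_0.
  - rewrite H6. apply Ropp_0.
  - rewrite H7. unfold Rdiv. ring.
Qed.

End Solution.

(** Keeping [m] and [S] in the conclusions treats all ranges of [beta] at once. The result is
    applied to [u] itself if [B < A], and to [-u] with exchanged parameters if [A < B]. *)
Lemma increasing_case (N : nat) (Rad : R) (g : R -> R) (A B p q : R) (U dU : R -> R -> R) :
  (2 <= N)%nat -> 0 < Rad -> smooth g -> (forall x, 0 <= x <= Rad -> 0 < g x) ->
  0 < B -> B < A -> 0 < p -> 0 < q ->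
  (forall eps, 0 < eps -> solves_Nstar N Rad g A B p q eps (U eps) (dU eps)) ->
  (forall eps, 0 < eps -> forall x y, 0 <= x -> x < y -> y <= Rad -> U eps x < U eps y) /\
  (forall kappa, 0 < kappa < 1 ->
     exists C M, 0 < C /\ 0 < M /\
       exists eps0, 0 < eps0 /\
         forall eps, 0 < eps < eps0 ->
           forall r, 0 <= r <= Rad - Rpower eps kappa ->
             Rabs (U eps r) <= C * Rpower eps kappa * ln (1 / eps) /\
             r ^ (N - 1) * Rabs (dU eps r) <= exp (- (M / Rpower eps (1 - kappa)))) /\
  (forall (beta gamma : R) (reb : R -> R),
     1 < beta -> 0 < gamma ->
     (forall eps, 0 < eps -> 0 < reb eps < Rad) ->
     lim0 (fun eps => (Rad - reb eps) / Rpower eps beta) gamma ->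
     let m := Rmin 1 (beta - 1) in
     let S := gamma * p * chi1 beta + 2 * INR N * g Rad / (Rad * (A - B)) * chi2 beta in
     lim0 (fun eps => U eps (reb eps) -
       (2 / p * m * ln (1 / eps) - 2 / p * ln (sqrt (B / (2 * p * g Rad)) * S))) 0 /\
     lim0 (fun eps => dU eps (reb eps) * Rpower eps (1 + m)) (2 / S) /\
     lim0 (fun eps => nstar_rhs N Rad A B p q (U eps) (reb eps) * Rpower eps (2 * m))
       (2 * p * g Rad / S ^ 2) /\
     (2 < beta -> lim0 (fun eps => U eps (reb eps) - U eps Rad) 0)).
Proof.
  intros HN HR Hg Hgpos HB HAB Hp Hq Hsol.
  assert (Hgc : forall x, continuous g x).
  { intros x. apply (@ex_derive_continuous R_AbsRing R_NormedModule g), (smooth_ex_derive g Hg). }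
  destruct (continuity_ab_min g 0 Rad) as [x1 [Hmin Hx1]]; [lra | |].
  { intros; apply continuity_pt_filterlim, Hgc. }
  destruct (continuity_ab_maj g 0 Rad) as [x2 [Hmaj Hx2]]; [lra | |].
  { intros; apply continuity_pt_filterlim, Hgc. }
  assert (Hgm : 0 < g x1) by now apply Hgpos.
  assert (Hbd : forall x, 0 <= x <= Rad -> g x1 <= g x <= g x2) by (split; auto).
  set (av := fun eps => charge_coeff N Rad A p (U eps)).
  set (bv := fun eps => charge_coeff N Rad B (- q) (U eps)).
  set (Uc := fun eps x => U eps (clamp Rad x)).
  set (Wc := fun eps x => dU eps (clamp Rad x)).
  assert (Hpr : forall eps, 0 < eps -> profile N Rad g A B p q eps (av eps) (bv eps) (Uc eps) (Wc eps)).
  { intros eps He. apply profile_of_solution; auto. }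
  split; [| split].
  - intros eps He x y Hx Hxy Hy.
    rewrite <- (clamp_id Rad x), <- (clamp_id Rad y) by lra.
    apply (profile_increasing N Rad g A B p q (g x1) (g x2) HN HR Hgc Hgm Hbd HB HAB Hp Hq
             eps _ _ _ _ He (Hpr eps He)); easy.
  - intros kappa Hk.
    destruct (interior_estimate N Rad g A B p q (g x1) (g x2) HN HR Hgc Hgm Hbd HB HAB Hp Hq
                av bv Uc Wc Hpr kappa Hk) as [C [e1 [HC [He1 H1]]]].
    destruct (interior_slope_estimate N Rad g A B p q (g x1) (g x2) HN HR Hgc Hgm Hbd HB HAB Hp Hq
                av bv Uc Wc Hpr kappa Hk) as [M [e2 [HM [He2 H2]]]].
    exists C, M. split; [easy |]. split; [easy |].
    exists (Rmin e1 e2). split; [now apply Rmin_glb_lt |]. intros eps [He Hlt] r Hr.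
    assert (Hlt1 := Rlt_le_trans _ _ _ Hlt (Rmin_l _ _)).
    assert (Hlt2 := Rlt_le_trans _ _ _ Hlt (Rmin_r _ _)).
    pose proof (Rpower_pos eps kappa).
    specialize (H1 eps (conj He Hlt1) r Hr). specialize (H2 eps (conj He Hlt2) r Hr).
    unfold Uc in H1. unfold Wc in H2. rewrite clamp_id in H1, H2 by lra. easy.
  - intros beta gamma reb Hbeta Hgamma Hreb Hlim m S.
    assert (Hcl : forall eps, 0 < eps -> clamp Rad (reb eps) = reb eps).
    { intros eps He. pose proof (Hreb eps He). apply clamp_id; lra. }
    repeat split.
    + apply (lim0_ext (fun eps => Uc eps (reb eps) -
       (2 / p * m * ln (1 / eps) - 2 / p * ln (sqrt (B / (2 * p * g Rad)) * S)))).
      { intros eps He. unfold Uc. now rewrite Hcl. }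
      apply (potential_expansion N Rad g A B p q (g x1) (g x2) HN HR Hgc Hgm Hbd HB HAB Hp Hq
                av bv Uc Wc Hpr beta gamma reb); easy.
    + apply (lim0_ext (fun eps => Wc eps (reb eps) * Rpower eps (1 + m))).
      { intros eps He. unfold Wc. now rewrite Hcl. }
      apply (slope_expansion N Rad g A B p q (g x1) (g x2) HN HR Hgc Hgm Hbd HB HAB Hp Hq
                av bv Uc Wc Hpr beta gamma reb); easy.
    + apply (lim0_ext (fun eps => react (av eps) (bv eps) p q (Uc eps (reb eps)) * Rpower eps (2 * m))).
      { intros eps He. unfold Uc. now rewrite Hcl, nstar_rhs_react. }
      apply (reaction_expansion N Rad g A B p q (g x1) (g x2) HN HR Hgc Hgm Hbd HB HAB Hp Hq
                av bv Uc Wc Hpr beta gamma reb); easy.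
    + intros Hb2. apply (lim0_ext (fun eps => Uc eps (reb eps) - Uc eps Rad)).
      { intros eps He. unfold Uc. rewrite (clamp_id Rad Rad) by lra. now rewrite Hcl. }
      apply (potential_near_end N Rad g A B p q (g x1) (g x2) HN HR Hgc Hgm Hbd HB HAB Hp Hq
                av bv Uc Wc Hpr beta gamma reb); easy.
Qed.

Lemma lim0_ratio (f h : R -> R) (l : R) :
  l <> 0 -> (forall e, 0 < e -> h e = f e / l) -> lim0 f l -> lim0 h 1.
Proof.
  intros Hl Hh Hf. apply (lim0_ext (fun e => f e / l)).
  - intros e He. now rewrite Hh.
  - apply (lim0_val _ (l / l)); [now apply Rinv_r |].
    apply lim0_div; [easy | easy | apply lim0_const].
Qed.

Lemma Rpower_2 (e : R) : 0 < e -> Rpower e 2 = e ^ 2.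
Proof. intros He. now rewrite <- Rpower_pow. Qed.

Theorem theorem5p1 (N : nat) (Rad : R) (g : R -> R) (A B p q : R)
  (U dU : R -> R -> R) :
  (2 <= N)%nat -> 0 < Rad -> smooth g -> (forall x, 0 <= x <= Rad -> 0 < g x) ->
  0 < A -> 0 < B -> 0 < p -> 0 < q -> A <> B ->
  (forall eps, 0 < eps -> solves_Nstar N Rad g A B p q eps (U eps) (dU eps)) ->
  (* monotonicity *)
  ((A < B -> forall eps, 0 < eps -> forall x y, 0 <= x -> x < y -> y <= Rad ->
      U eps y < U eps x) /\
   (B < A -> forall eps, 0 < eps -> forall x y, 0 <= x -> x < y -> y <= Rad ->
      U eps x < U eps y)) /\
  (* (I) *)
  (forall kappa, 0 < kappa < 1 ->
     exists C M, 0 < C /\ 0 < M /\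
       exists eps0, 0 < eps0 /\
         forall eps, 0 < eps < eps0 ->
           forall r, 0 <= r <= Rad - Rpower eps kappa ->
             Rabs (U eps r) <= C * Rpower eps kappa * ln (1 / eps) /\
             r ^ (N - 1) * Rabs (dU eps r) <= exp (- (M / Rpower eps (1 - kappa)))) /\
  (* (II) *)
  (forall (beta gamma : R) (reb : R -> R),
     1 < beta -> 0 < gamma ->
     (forall eps, 0 < eps -> 0 < reb eps < Rad) ->
     filterlim (fun eps => (Rad - reb eps) / Rpower eps beta) (at_right 0) (locally gamma) ->
     (A < B ->
        filterlim (fun eps => U eps (reb eps) -
          (- (2 / q) * Rmin 1 (beta - 1) * ln (1 / eps)
           + (2 / q) * ln (sqrt (A / (2 * q * g Rad)) *
               (gamma * q * chi1 beta + 2 * INR N * g Rad / (Rad * (B - A)) * chi2 beta))))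
          (at_right 0) (locally 0)) /\
     (B < A ->
        filterlim (fun eps => U eps (reb eps) -
          ((2 / p) * Rmin 1 (beta - 1) * ln (1 / eps)
           - (2 / p) * ln (sqrt (B / (2 * p * g Rad)) *
               (gamma * p * chi1 beta + 2 * INR N * g Rad / (Rad * (A - B)) * chi2 beta))))
          (at_right 0) (locally 0)) /\
     (A < B ->
        (* (a) *)
        (beta < 2 ->
           filterlim (fun eps => dU eps (reb eps) /
               (- (2 / (gamma * q)) * Rpower eps (- beta))) (at_right 0) (locally 1) /\
           filterlim (fun eps => rho N Rad A B p q (U eps) (reb eps) /
               (2 * g Rad / (gamma ^ 2 * q) * Rpower eps (- (2 * (beta - 1)))))
             (at_right 0) (locally 1)) /\
        (* (b) *)
        (beta = 2 ->
           filterlim (fun eps => dU eps (reb eps) /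
               (- (2 / (gamma * q + 2 * INR N * g Rad / (Rad * (B - A)))) / eps ^ 2))
             (at_right 0) (locally 1) /\
           filterlim (fun eps => rho N Rad A B p q (U eps) (reb eps) /
               (2 * q * g Rad / (gamma * q + 2 * INR N * g Rad / (Rad * (B - A))) ^ 2
                / eps ^ 2))
             (at_right 0) (locally 1)) /\
        (* (c) *)
        (2 < beta ->
           filterlim (fun eps => dU eps (reb eps) /
               (- (Rad * (B - A) / (INR N * g Rad)) / eps ^ 2)) (at_right 0) (locally 1) /\
           filterlim (fun eps => rho N Rad A B p q (U eps) (reb eps) /
               (q * Rad ^ 2 * (B - A) ^ 2 / (2 * INR N ^ 2 * g Rad) / eps ^ 2))
             (at_right 0) (locally 1) /\
           filterlim (fun eps => U eps (reb eps) - U eps Rad) (at_right 0) (locally 0) /\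
           filterlim (fun eps => dU eps (reb eps) / dU eps Rad) (at_right 0) (locally 1)))).

Proof.
  intros HN HR Hg Hgpos HA HB Hp Hq HAB Hsol.
  assert (Hopp : forall eps, 0 < eps ->
    solves_Nstar N Rad g B A q p eps (fun x => - U eps x) (fun x => - dU eps x)).
  { intros eps He. apply solves_Nstar_opp; auto. }
  assert (Hinc := fun h : B < A => increasing_case N Rad g A B p q U dU
                    HN HR Hg Hgpos HB h Hp Hq Hsol).
  assert (Hdec := fun h : A < B => increasing_case N Rad g B A q p
                    (fun eps x => - U eps x) (fun eps x => - dU eps x)
                    HN HR Hg Hgpos HA h Hq Hp Hopp).
  assert (HgR : 0 < g Rad) by (apply Hgpos; lra). assert (HN0 := INR_dim_pos N HN).
  split; [split | split].
  - intros h eps He x y Hx Hxy Hy.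
    destruct (Hdec h) as [H _]. specialize (H eps He x y Hx Hxy Hy). cbv beta in H. lra.
  - intros h. apply (Hinc h).
  - intros kappa Hk. destruct (Rtotal_order A B) as [h | [h | h]]; [| easy |].
    + destruct (Hdec h) as [_ [H _]].
      destruct (H kappa Hk) as [C [M [HC [HM [e0 [He0 H0]]]]]].
      exists C, M. split; [easy |]. split; [easy |]. exists e0. split; [easy |].
      intros eps He r Hr. specialize (H0 eps He r Hr). now rewrite !Rabs_Ropp in H0.
    + now apply (Hinc h).
  - intros beta gamma reb Hbeta Hgamma Hreb Hlim. split; [| split].
    + intros h. destruct (Hdec h) as [_ [_ H]].
      destruct (H beta gamma reb Hbeta Hgamma Hreb Hlim) as [H1 _].
      apply (lim0_val _ (-1 * 0)); [ring |].
      refine (lim0_ext _ _ _ _ (lim0_scal (-1) _ _ H1)).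
      intros eps He. ring.
    + intros h. destruct (Hinc h) as [_ [_ H]].
      apply (H beta gamma reb Hbeta Hgamma Hreb Hlim).
    + intros h. destruct (Hdec h) as [_ [_ H]].
      destruct (H beta gamma reb Hbeta Hgamma Hreb Hlim) as [_ [H2 [H3 H4]]].
      assert (HD : 0 < 2 * INR N * g Rad / (Rad * (B - A))).
      { apply Rdiv_lt_0_compat; repeat apply Rmult_lt_0_compat; lra. }
      assert (Hgq : 0 < gamma * q) by now apply Rmult_lt_0_compat.
      unfold chi1, chi2 in H2, H3. split; [| split].
      (* Here only the increment of [v] counts: the exponent is [beta - 1] and the sum reduces to
         [gamma q]. *)
      * intros Hb. destruct (Rle_dec beta 2); [| lra]. destruct (Rlt_dec beta 2); [| lra].
        rewrite Rmin_right in H2, H3 by lra.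
        split; [refine (lim0_ratio _ _ _ _ _ H2) | refine (lim0_ratio _ _ _ _ _ H3)].
        -- rewrite Rmult_0_r, Rplus_0_r, Rmult_1_r.
           apply Rgt_not_eq, Rdiv_lt_0_compat; lra.
        -- intros eps He. replace (1 + (beta - 1)) with beta by ring.
           rewrite Rpower_Ropp. pose proof (Rpower_pos eps beta). field. lra.
        -- rewrite Rmult_0_r, Rplus_0_r, Rmult_1_r.
           apply Rgt_not_eq, Rdiv_lt_0_compat; [| now apply pow_lt].
           repeat apply Rmult_lt_0_compat; lra.
        (* The right side of the equation for [-u] is minus the one for [u], which is exactly the
           charge density. *)
        -- intros eps He. rewrite nstar_rhs_opp. unfold rho.
           rewrite Rpower_Ropp. pose proof (Rpower_pos eps (2 * (beta - 1))). field. lra.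
      * intros Hb. destruct (Rle_dec beta 2); [| lra]. destruct (Rlt_dec beta 2); [lra |].
        rewrite Rmin_left in H2, H3 by lra.
        rewrite !Rmult_1_r in H2. rewrite !Rmult_1_r in H3.
        set (S := gamma * q + 2 * INR N * g Rad / (Rad * (B - A))) in *.
        assert (HS : 0 < S) by (unfold S; lra).
        split; [refine (lim0_ratio _ _ _ _ _ H2) | refine (lim0_ratio _ _ _ _ _ H3)].
        -- apply Rgt_not_eq, Rdiv_lt_0_compat; lra.
        -- intros eps He. replace (1 + 1) with 2 by ring. rewrite Rpower_2 by easy. field. lra.
        -- apply Rgt_not_eq, Rdiv_lt_0_compat; [| now apply pow_lt].
           repeat apply Rmult_lt_0_compat; lra.
        -- intros eps He. rewrite nstar_rhs_opp. unfold rho.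
           rewrite Rpower_2 by easy. field. lra.
      * intros Hb. destruct (Rle_dec beta 2); [lra |]. destruct (Rlt_dec beta 2); [lra |].
        rewrite Rmin_left in H2, H3 by lra.
        rewrite Rmult_0_r, Rplus_0_l, Rmult_1_r in H2.
        rewrite Rmult_0_r, Rplus_0_l, !Rmult_1_r in H3.
        assert (Hne : 2 / (2 * INR N * g Rad / (Rad * (B - A))) <> 0)
          by (apply Rgt_not_eq, Rdiv_lt_0_compat; lra).
        split; [refine (lim0_ratio _ _ _ Hne _ H2) |].
        { intros eps He. replace (1 + 1) with 2 by ring. rewrite Rpower_2 by easy. field. lra. }
        split; [refine (lim0_ratio _ _ _ _ _ H3) |].
        { apply Rgt_not_eq, Rdiv_lt_0_compat; [| now apply pow_lt].
          repeat apply Rmult_lt_0_compat; lra. }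
        { intros eps He. rewrite nstar_rhs_opp. unfold rho.
          rewrite Rpower_2 by easy. field. lra. }
        split.
        { apply (lim0_val _ (-1 * 0)); [ring |].
          refine (lim0_ext _ _ _ _ (lim0_scal (-1) _ _ (H4 Hb))).
          intros eps He. ring. }
        refine (lim0_ratio _ _ _ Hne _ H2). intros eps He.
        (* The boundary condition gives [u'(R)] exactly, and it coincides with the leading term
           found at [reb]. *)
        destruct (Hsol eps He) as [_ [_ [_ [_ [_ ->]]]]].
        replace (1 + 1) with 2 by ring. rewrite Rpower_2 by easy. field. lra.
Qed.
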